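(* Let $(\gamma,\delta,N)$ be a gamma triple representing the hypergeometric parameters $(\alpha\,;\beta)\in\mathbb{Q}^n\times\mathbb{Q}^n$. Let $q$ be a prime power for which both $F_q(\gamma,\delta,N\mid t)$ and $F_q(\alpha\,;\beta\mid t)$ are defined, i.e. such that $q$ is coprime to $\gamma_1\cdots\gamma_{d+2}$, $N$ divides $q-1$, and $(q-1)\alpha,(q-1)\beta\in\mathbb{Z}^n$. Then for all $t\in\mathbb{F}_q^\times$, $$F_q(\gamma,\delta,N\mid t)=F_q(\alpha\,;\beta\mid t).$$
   Context: For a prime power $q$ put $q^\times=q-1$. Fix a non-trivial additive character $\psi:\mathbb{F}_q\to\mathbb{C}^\times$ and a multiplicative character $\chi:\mathbb{F}_q^\times\to\mathbb{C}^\times$ of order $q^\times$; write $\chi^m(x)=\chi(x)^m$ and $\zeta_k=e^{2\pi i/k}$. The Gauss sum is $g(m)=\sum_{u\in\mathbb{F}_q^\times}\psi(u)\chi^m(u)$ for $m\in\mathbb{Z}$. Hypergeometric parameters $(\alpha\,;\beta)$ are vectors $\alpha,\beta\in\mathbb{Q}^n$ ($n\ge 0$) such that $\alpha_i-\beta_j\notin\mathbb{Z}$ for all $i,j$. If $q^\times\alpha,q^\times\beta\in\mathbb{Z}^n$, then for $t\in\mathbb{F}_q^\times$ $$F_q(\alpha\,;\beta\mid t)=\frac{1}{1-q}\sum_{m=0}^{q^\times-1}\prod_{i=1}^n\frac{g(m+\alpha_iq^\times)\,g(-m-\beta_iq^\times)}{g(\alpha_iq^\times)\,g(-\beta_iq^\times)}\;\chi((-1)^nt)^m.$$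 A gamma vector is $\gamma\in\mathbb{Z}^{d+2}$ with all components non-zero, $\sum_j\gamma_j=0$ and $\gcd(\gamma_1,\dots,\gamma_{d+2})=1$. A gamma triple $(\gamma,\delta,N)$ consists of a gamma vector $\gamma\in\mathbb{Z}^{d+2}$, a vector $\delta\in\mathbb{Z}^{d+2}$ and a positive integer $N$. It represents $(\alpha\,;\beta)$ if $$\frac{\prod_{j=1}^n(T-e^{2\pi i\alpha_j})}{\prod_{j=1}^n(T-e^{2\pi i\beta_j})}=\frac{\prod_{\gamma_j<0}(T^{-\gamma_j}-\zeta_N^{\delta_j})}{\prod_{\gamma_j>0}(T^{\gamma_j}-\zeta_N^{-\delta_j})},$$ where the numerator and denominator on the left have no common factor. Let $D(T)$ be the greatest common divisor in $\mathbb{C}[T]$ of the numerator and the denominator of the right-hand side, and let $s_\delta(m)$ be the multiplicity of $e^{2\pi i m/q^\times}$ as a zero of $D(T)$. If $q$ is coprime to $\gamma_1\cdots\gamma_{d+2}$ and $N\mid q^\times$, then for $t\in\mathbb{F}_q^\times$ $$F_q(\gamma,\delta,N\mid t)=\frac{1}{1-q}\sum_{m=0}^{q^\times-1}\prod_{j=1}^{d+2}\frac{g\left(-\gamma_jm+\frac{\delta_j}{N}q^\times\right)}{g\left(\frac{\delta_j}{N}q^\times\right)}\;q^{s_\delta(-m)-s_\delta(0)}\,\chi^m(\gamma^\gamma t),\qquad \gamma^\gamma=\prod_{j=1}^{d+2}\gamma_j^{\gamma_j}.$$ *)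

(* Defs.v *)
From mathcomp Require Import all_boot all_order all_algebra.
From mathcomp Require Import reals trigo.
From mathcomp Require Import complex.

Set Implicit Arguments.
Unset Strict Implicit.
Unset Printing Implicit Defensive.

Import Order.TTheory GRing.Theory Num.Theory.

Local Open Scope ring_scope.
Local Open Scope complex_scope.

Definition e2pii (R : realType) (x : rat) : R[i] :=
  cos (2 * pi * ratr x) +i* sin (2 * pi * ratr x).

Definition zeta (R : realType) (k : nat) : R[i] := e2pii R (k%:R^-1).

Definition qx (F : finFieldType) : nat := #|F|.-1.

Definition additive_character (R : realType) (F : finFieldType)
    (psi : F -> R[i]) : Prop :=
  psi 0 = 1 /\ forall x y, psi (x + y) = psi x * psi y.

Definition nontrivial_additive_character (R : realType) (F : finFieldType)
    (psi : F -> R[i]) : Prop :=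
  additive_character psi /\ exists x, psi x <> 1.

(* Characters of the multiplicative group are functions on all of F, of which
   only the values at nonzero elements are constrained or ever used. *)
Definition multiplicative_character (R : realType) (F : finFieldType)
    (chi : F -> R[i]) : Prop :=
  chi 1 = 1 /\
  forall x y, x != 0 -> y != 0 -> chi (x * y) = chi x * chi y.

Definition character_order (R : realType) (F : finFieldType)
    (chi : F -> R[i]) (k : nat) : Prop :=
  [/\ (0 < k)%N,
      forall x, x != 0 -> chi x ^+ k = 1
    & forall m : nat, (0 < m)%N ->
        (forall x, x != 0 -> chi x ^+ m = 1) -> (k <= m)%N].

Definition gauss_sum (R : realType) (F : finFieldType) (psi chi : F -> R[i])
    (m : int) : R[i] :=
  \sum_(u : F | u != 0) psi u * chi u ^ m.

Definition hypergeometric_parameters (n : nat) (alpha beta : 'I_n -> rat)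
    : Prop :=
  forall i j, alpha i - beta j \isn't a Num.int.

(* Only meaningful when (q - 1) * a is an integer, in which case the floor is
   that integer. *)
Definition scale_qx (F : finFieldType) (a : rat) : int :=
  Num.floor ((qx F)%:R * a).

Definition F_q_params_defined (F : finFieldType) (n : nat)
    (alpha beta : 'I_n -> rat) : Prop :=
  (forall i, (qx F)%:R * alpha i \is a Num.int) /\
  (forall i, (qx F)%:R * beta i \is a Num.int).

Definition F_q_params (R : realType) (F : finFieldType) (psi chi : F -> R[i])
    (n : nat) (alpha beta : 'I_n -> rat) (t : F) : R[i] :=
  let g := gauss_sum psi chi in
  (1 - #|F|%:R)^-1 *
  \sum_(m < qx F)
    (\prod_(i < n)
       ((g (m%:Z + scale_qx F (alpha i)) * g (- m%:Z - scale_qx F (beta i))) /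
        (g (scale_qx F (alpha i)) * g (- scale_qx F (beta i))))) *
    chi ((-1) ^+ n * t) ^+ m.

Definition gamma_vector (d : nat) (gamma : 'I_d.+2 -> int) : Prop :=
  [/\ forall j, gamma j != 0,
      \sum_j gamma j = 0
    & \big[gcdn/0%N]_j `|gamma j|%N = 1%N].

Definition gamma_triple (d : nat) (gamma delta : 'I_d.+2 -> int) (N : nat)
    : Prop :=
  gamma_vector gamma /\ (0 < N)%N.

Definition gamma_num (R : realType) (d : nat) (gamma delta : 'I_d.+2 -> int)
    (N : nat) : {poly R[i]} :=
  \prod_(j | gamma j < 0) ('X^(`|gamma j|%N) - (zeta R N ^ delta j)%:P).

Definition gamma_den (R : realType) (d : nat) (gamma delta : 'I_d.+2 -> int)
    (N : nat) : {poly R[i]} :=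
  \prod_(j | 0 < gamma j) ('X^(`|gamma j|%N) - (zeta R N ^ (- delta j))%:P).

Definition param_poly (R : realType) (n : nat) (a : 'I_n -> rat)
    : {poly R[i]} :=
  \prod_j ('X - (e2pii R (a j))%:P).

Definition represents (R : realType) (d : nat) (gamma delta : 'I_d.+2 -> int)
    (N : nat) (n : nat) (alpha beta : 'I_n -> rat) : Prop :=
  coprimep (param_poly R alpha) (param_poly R beta) /\
  tofrac (param_poly R alpha) / tofrac (param_poly R beta) =
  tofrac (gamma_num R gamma delta N) / tofrac (gamma_den R gamma delta N).

Definition gamma_gcd (R : realType) (d : nat) (gamma delta : 'I_d.+2 -> int)
    (N : nat) : {poly R[i]} :=
  gcdp (gamma_num R gamma delta N) (gamma_den R gamma delta N).

Definition s_delta (R : realType) (F : finFieldType) (d : nat)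
    (gamma delta : 'I_d.+2 -> int) (N : nat) (m : int) : nat :=
  mup (e2pii R (m%:~R / (qx F)%:R)) (gamma_gcd R gamma delta N).

Definition F_q_gamma_defined (F : finFieldType) (d : nat)
    (gamma : 'I_d.+2 -> int) (N : nat) : Prop :=
  coprime #|F| `|(\prod_j gamma j)%R|%N /\ (N %| qx F)%N.

Definition gamma_gamma (F : finFieldType) (d : nat) (gamma : 'I_d.+2 -> int)
    : F :=
  \prod_j ((gamma j)%:~R ^ gamma j).

Definition F_q_gamma (R : realType) (F : finFieldType) (psi chi : F -> R[i])
    (d : nat) (gamma delta : 'I_d.+2 -> int) (N : nat) (t : F) : R[i] :=
  let g := gauss_sum psi chi in
  let s := s_delta R F gamma delta N in
  let shift j := scale_qx F ((delta j)%:~R / N%:R) in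
  (1 - #|F|%:R)^-1 *
  \sum_(m < qx F)
    (\prod_j (g (- gamma j * m%:Z + shift j) / g (shift j))) *
    #|F|%:R ^ ((s (- m%:Z))%:Z - (s 0)%:Z) *
    chi (gamma_gamma F gamma * t) ^+ m.

(* Main.v *)
Require Import Defs.
From HB Require Import structures.
From mathcomp Require Import all_boot all_order all_algebra.
From mathcomp Require Import all_solvable all_field ring lra.
From mathcomp Require Import reals trigo complex.

(** Write Q = q - 1 and g for the Gauss sum.  To a pair (k, c) with k prime to q
attach the polynomial X^k - exp(2 pi i c / Q) and, for each m, the number
Phi_m(k, c) = g(k m + c) / g(c) * chi(k)^(- k m).  The reflection formula for
g(c) g(-c) turns the m-th terms of the two hypergeometric sums into products of
such numbers, times powers of q: numerator factors and the alpha_i contribute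
Phi_m, denominator factors and the beta_i contribute its inverse.

The hypothesis that the gamma triple represents (alpha; beta) is a
multiplicative relation between the attached polynomials, and it has to be
transported to Phi_m.  The product formula of Hasse and Davenport, for l
dividing Q, says exactly that Phi_m respects the elementary relation
X^(k l) - z^l = prod_(w^l = 1) (X^k - w z).  These elementary relations generate
all others (kummer_poly_relation).  Indeed they allow one to assume that no
prime l divides k, Q and c for any pair (k, c) that occurs.  Such a pair is
determined by a well chosen root of its polynomial: some a = c mod Q is prime to
k, and if exp(2 pi i a / (k Q)) is a root of the polynomial of (k', c'), then k
divides k', and c' = c mod Q when k' = k.  A pair with k maximal therefore has
to occur on both sides of the relation, and it cancels.  In particular the
gamma_j need not divide Q, and Gauss sums over extensions of the base field do
not enter this step.

The powers of q match because the denominator of the gamma side is, up to a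
constant, the gcd D times prod_j (X - exp(2 pi i beta_j)) (s_delta_eq).

The product formula itself (hasse_davenport_product) is proved with generating
functions.  For a function h on monic polynomials that turns products into
products, the sums S_n of h over the monic polynomials of degree n satisfy
n S_n = sum_(1 <= r <= n) T_r S_(n - r), where T_r is a sum over the elements of
the extension of degree r (monic_sum_recurrence).  For the function h_c
given by psi(sum of the roots) chi^c(product of the roots), S_1 = g(c) and
S_n = 0 for n > 1, so T_r = (-1)^(r - 1) g(c)^r: this is the lifting theorem of
Hasse and Davenport.  Now take h to be psi(sum of the l-th powers of the roots)
chi^(l m)(product of the roots).  Its T_r is the sum over i < l of the T_r of
h_(m + i Q / l), because an element x of the extension has l or 0 roots of order
l according to the value at its norm of the characters of order dividing l.
Newton's identities then give S_l = prod_(i < l) g(m + i Q / l).  On the other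
hand the l-th power sum of the roots of X f + a is - l a plus a quantity that
does not involve a, so S_l is also a constant times chi(l)^(- l m) g(l m). *)

Set Implicit Arguments.
Unset Strict Implicit.
Unset Printing Implicit Defensive.

Import Order.TTheory GRing.Theory Num.Theory.

Local Open Scope ring_scope.

(** * Frobenius orbits and their polynomials *)

(** The embedding is an argument so that the ring morphism structure declared
below, which rests on it, can be inferred. *)
Definition frob (F : finFieldType) (K : fieldType) (iota : {rmorphism F -> K})
  (x : K) : K := x ^+ #|F|.

Lemma pnat_card_finField (F : finFieldType) : [pchar F].-nat #|F|.
Proof.
have [p p_pr pcharFp] := finPcharP F.
have := card_pprimeChar pcharFp; rewrite -[#|pPrimeCharType _|]/#|F| => ->.
by rewrite pnatX pnatE ?pcharFp.
Qed.

Lemma natr_card_finField (F : finFieldType) : #|F|%:R = 0 :> F.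
Proof.
have : \sum_(x : F) x = \sum_(x : F) (1 + x) by apply: reindex_inj; apply: addrI.
rewrite big_split /= sumr_const => /esym/eqP.
by rewrite -[X in _ == X]add0r (inj_eq (addIr _)) => /eqP.
Qed.

Section FrobeniusMorphism.
Variables (F : finFieldType) (K : fieldType) (iota : {rmorphism F -> K}).

Lemma frobD x y : (x + y) ^+ #|F| = x ^+ #|F| + y ^+ #|F| :> K.
Proof.
apply: exprDn_pchar; rewrite (eq_pnat _ (fmorph_pchar iota)).
exact: pnat_card_finField.
Qed.

Lemma card_finField_gt0 : (0 < #|F|)%N.
Proof. exact: ltnW (finNzRing_gt1 F). Qed.

Lemma frob_is_zmod_morphism : zmod_morphism (frob iota).
Proof.
move=> x y; apply/eqP; rewrite eq_sym subr_eq.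
by rewrite /frob -frobD subrK.
Qed.

Lemma frob_is_monoid_morphism : monoid_morphism (frob iota).
Proof. by split=> [|x y]; rewrite /frob ?expr1n ?exprMn. Qed.

HB.instance Definition _ :=
  GRing.isZmodMorphism.Build K K (frob iota) frob_is_zmod_morphism.
HB.instance Definition _ :=
  GRing.isMonoidMorphism.Build K K (frob iota) frob_is_monoid_morphism.

Lemma frob_rmorph x : frob iota (iota x) = iota x.
Proof. by rewrite /frob -rmorphXn expf_card. Qed.

Lemma frob_fixedP x : frob iota x = x -> exists a, iota a = x.
Proof.
move=> fx; have [/existsP[a /eqP <-]|] := boolP [exists a, iota a == x].
  by exists a.
rewrite negb_exists => /forallP nx.
pose p : {poly K} := 'X^#|F| - 'X.
have szp : size p = #|F|.+1.
  by rewrite size_polyDl ?size_polyXn // size_polyN size_polyX ltnS finNzRing_gt1.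
have pn0 : p != 0 by rewrite -size_poly_gt0 szp.
have fix_root z : frob iota z = z -> root p z.
  by move=> fz; rewrite /root !hornerE -/(frob iota z) fz subrr.
suff: (size (x :: [seq iota a | a <- enum F]) < size p)%N.
  by rewrite /= size_map szp -cardE ltnn.
apply: max_poly_roots => //.
  rewrite /= fix_root //=; apply/allP => _ /mapP[a _ ->].
  by apply/fix_root/frob_rmorph.
rewrite /= map_inj_uniq ?enum_uniq ?andbT; last exact: fmorph_inj.
by apply/mapP => -[a _ /eqP]; rewrite eq_sym (negPf (nx a)).
Qed.

Definition descend (x : K) : F := odflt 0 [pick a | iota a == x].

Lemma descendK x : frob iota x = x -> iota (descend x) = x.
Proof.
move=> /frob_fixedP[a ax]; rewrite /descend; case: pickP => [b /eqP //|].
by move=> /(_ a); rewrite ax eqxx.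
Qed.

Lemma rmorph_descend a : descend (iota a) = a.
Proof. by apply: (fmorph_inj iota); rewrite descendK ?frob_rmorph. Qed.

Lemma map_descendK (p : {poly K}) : map_poly (frob iota) p = p ->
  map_poly iota (map_poly descend p) = p.
Proof.
move=> fp; apply/polyP => i; rewrite coef_map coef_map_id0; last first.
  by rewrite -(rmorph0 iota) rmorph_descend.
by apply: descendK; rewrite -coef_map fp.
Qed.

Lemma iter_frobE r (x : K) : iter r (frob iota) x = x ^+ (#|F| ^ r).
Proof. by elim: r => //= r ->; rewrite /frob -exprM expnSr. Qed.

Lemma iter_frobD r r' (y : K) : iter (r + r') (frob iota) y =
  iter r' (frob iota) (iter r (frob iota) y).
Proof. by rewrite addnC iterD. Qed.

(** When y lies in the extension of degree r, this is the characteristic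
polynomial of y over F: a power of the minimal polynomial. *)
Definition orbit_poly r (y : K) : {poly F} :=
  map_poly descend (\prod_(0 <= i < r) ('X - (iter i (frob iota) y)%:P)).

Lemma orbit_polyE r y : iter r (frob iota) y = y ->
  map_poly iota (orbit_poly r y) =
  \prod_(0 <= i < r) ('X - (iter i (frob iota) y)%:P).
Proof.
move=> yr; apply: map_descendK; rewrite map_prod_XsubC.
case: r yr => [|r] yr; first by rewrite !big_nil.
by rewrite big_nat_recr //= big_nat_recl //= mulrC -iterS yr.
Qed.

Lemma orbit_poly_monic r y : iter r (frob iota) y = y -> orbit_poly r y \is monic.
Proof.
move=> yr; rewrite -(map_monic iota) orbit_polyE //.
by rewrite monic_prod_XsubC.
Qed.

Lemma size_orbit_poly r y : iter r (frob iota) y = y ->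
  size (orbit_poly r y) = r.+1.
Proof.
move=> yr; rewrite -(size_map_poly iota) orbit_polyE //.
by rewrite size_prod_XsubC size_iota subn0.
Qed.

Lemma orbit_polyD d r y : iter d (frob iota) y = y -> iter r (frob iota) y = y ->
  orbit_poly (r + d) y = orbit_poly r y * orbit_poly d y.
Proof.
move=> yd yr; apply: (map_inj_poly (fmorph_inj iota) (rmorph0 iota)).
rewrite rmorphM /= (orbit_polyE yd) (orbit_polyE yr) orbit_polyE; last first.
  by rewrite iter_frobD yr.
rewrite (@big_cat_nat _ _ _ r) ?leq_addr //=; congr (_ * _).
rewrite [X in X = _](@big_addn _ _ _ 0 (r + d) r) addKn; apply: eq_bigr => i _.
by rewrite addnC iter_frobD yr.
Qed.

Lemma root_orbit_poly r y : (0 < r)%N -> iter r (frob iota) y = y ->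
  root (map_poly iota (orbit_poly r y)) y.
Proof.
case: r => // r _ yr; rewrite orbit_polyE // big_nat_recl //=.
by rewrite rootM root_XsubC eqxx.
Qed.

Lemma root_iter_frob (f : {poly F}) i y :
  root (map_poly iota f) y -> root (map_poly iota f) (iter i (frob iota) y).
Proof.
move=> fy; elim: i => //= i /eqP IH; apply/eqP.
rewrite -[RHS](rmorph0 (frob iota)) -IH -horner_map -map_poly_comp.
congr (_.[_]); apply/polyP => j; rewrite !coef_map /=.
by rewrite frob_rmorph.
Qed.

Lemma iter_frob_inj i : injective (iter i (frob iota)).
Proof. by elim: i => // i IH x y /= /fmorph_inj/IH. Qed.

(** If y has degree d over F, the indices r that count are the multiples j d
such that the j-th power of the minimal polynomial divides f.  The induction
divides f by the minimal polynomial, which has y as a simple root, so that both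
sides drop by one. *)
Lemma orbit_count_at (f : {poly F}) (y : K) : f \is monic ->
  (\sum_(1 <= r < size f) ((iter r (frob iota) y == y) && (orbit_poly r y %| f)%R)
   = mup y (map_poly iota f))%N.
Proof.
have [n] := ubnP (size f); elim: n f => // n IH f; rewrite ltnS => szf monf.
have fn0 := monic_neq0 monf.
have [fy|nfy] := boolP (root (map_poly iota f) y); last first.
  rewrite mupNroot // big_nat; apply: big1 => r /andP[r0 _].
  case: eqP => //= yr; rewrite -(dvdp_map iota); case: (boolP (_ %| _)) => // D.
  by case/negP: nfy; apply: (root_dvdp D); apply: root_orbit_poly.
have [d0 [d0_gt0 /eqP yd0]] : exists d, (0 < d)%N /\ iter d (frob iota) y == y.
  (* The iterates of y are roots of f, hence two of them coincide. *)
  have /(uniqPn 0)[i [j [ij]]] : ~~ uniq (mkseq (fun i => iter i (frob iota) y) (size f)).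
    apply/negP => u.
    suff: (size (mkseq (fun i => iter i (frob iota) y) (size f)) <
           size (map_poly iota f))%N by rewrite size_mkseq size_map_poly ltnn.
    apply: max_poly_roots => //; first by rewrite map_poly_eq0.
    by apply/allP => _ /mapP[i _ ->]; apply: root_iter_frob.
  rewrite size_mkseq => jf; rewrite !nth_mkseq //; last exact: ltn_trans jf.
  move=> e; exists (j - i)%N; split; rewrite ?subn_gt0 //.
  by apply/eqP/(@iter_frob_inj i); rewrite -iterD subnKC // ltnW.
have ex_d : exists d, (0 < d)%N && (iter d (frob iota) y == y).
  by exists d0; rewrite d0_gt0 yd0 eqxx.
case: (ex_minnP ex_d) => d /andP[d_gt0 /eqP yd] min_d {ex_d d0 d0_gt0 yd0}.
have uorb : uniq (mkseq (fun i => iter i (frob iota) y) d).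
  apply/(uniqPn 0) => -[i [j [ij]]].
  rewrite size_mkseq => jd; rewrite !nth_mkseq ?(ltn_trans ij) // => e.
  have /min_d : (0 < j - i)%N && (iter (j - i) (frob iota) y == y).
    rewrite subn_gt0 ij; apply/eqP/(@iter_frob_inj i).
    by rewrite -iterD subnKC // ltnW.
  by rewrite leqNgt; case/negP; apply: leq_ltn_trans jd; rewrite leq_subr.
have orbE' : map_poly iota (orbit_poly d y) =
    \prod_(z <- mkseq (fun i => iter i (frob iota) y) d) ('X - z%:P).
  by rewrite orbit_polyE // big_map /index_iota subn0.
have dvd_f : orbit_poly d y %| f.
  rewrite -(dvdp_map iota) orbE'; apply: uniq_roots_dvdp; last by rewrite uniq_rootsE.
  by apply/allP => _ /mapP[i _ ->]; apply: root_iter_frob.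
have /dvdpP[f1 fE] := dvd_f.
have mono := orbit_poly_monic yd.
have mon1 : f1 \is monic by rewrite -(monicMr _ mono) -fE.
have f1n0 := monic_neq0 mon1.
have szfE : size f = (size f1 + d)%N.
  by rewrite fE size_monicM ?monic_neq0 // size_orbit_poly // addnS.
have mupo : mup y (map_poly iota (orbit_poly d y)) = 1%N.
  rewrite orbE' mu_prod_XsubC count_uniq_mem //.
  by rewrite (_ : y \in _) //; apply/mapP; exists 0%N; rewrite ?mem_iota.
have sz1 : (0 < size f1)%N by rewrite size_poly_gt0.
rewrite [in RHS]fE rmorphM /= mupM ?map_poly_eq0 ?monic_neq0 // mupo -IH //; last first.
  by apply: leq_trans szf; rewrite szfE -addn1 leq_add2l.
rewrite (@big_cat_nat _ _ _ d) //=; last by rewrite szfE leq_addl.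
rewrite big_nat big1 ?add0n => [|r /andP[r0 rd]]; last first.
  case: eqP => //= yr; have := min_d r.
  by rewrite r0 yr eqxx leqNgt rd => /(_ isT).
rewrite szfE big_ltn; last by rewrite -addn1 addnC leq_add2r.
rewrite yd eqxx dvd_f addnC; congr (_ + _)%N.
rewrite [LHS](@big_addn _ _ _ 1 (size f1 + d) d) addnK; apply: eq_bigr => r _.
rewrite addnC iter_frobD yd; case: eqP => //= yr.
by rewrite addnC orbit_polyD // fE dvdp_mul2r // monic_neq0.
Qed.
End FrobeniusMorphism.

(** * Sums over monic polynomials *)

Section OrbitRecurrence.
Variables (F : finFieldType) (K : closedFieldType) (iota : {rmorphism F -> K}).

Definition conj_roots (f : {poly F}) : seq K :=
  sval (closed_field_poly_normal (map_poly iota f)).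

Lemma conj_rootsE f : f \is monic ->
  map_poly iota f = \prod_(y <- conj_roots f) ('X - y%:P).
Proof.
move=> monf; rewrite /conj_roots; case: (closed_field_poly_normal _) => s /= fE.
by rewrite {1}fE lead_coef_map (monicP monf) rmorph1 scale1r.
Qed.

Lemma prod_XsubC_perm (k : fieldType) (s1 s2 : seq k) :
  \prod_(y <- s1) ('X - y%:P) = \prod_(y <- s2) ('X - y%:P) -> perm_eq s1 s2.
Proof. by move=> e; apply/allP => y _ /=; rewrite -!mu_prod_XsubC e. Qed.

Lemma size_conj_roots f : f \is monic -> size f = (size (conj_roots f)).+1.
Proof.
by move=> monf; rewrite -(size_map_poly iota) conj_rootsE // size_prod_XsubC.
Qed.

Lemma conj_roots_mul f g : f \is monic -> g \is monic ->
  perm_eq (conj_roots (f * g)) (conj_roots f ++ conj_roots g).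
Proof.
move=> mf mg; apply: prod_XsubC_perm.
by rewrite big_cat -!conj_rootsE ?monicMl // rmorphM.
Qed.

Lemma conj_roots_orbit r y : iter r (frob iota) y = y ->
  perm_eq (conj_roots (orbit_poly iota r y)) [seq iter i (frob iota) y | i <- seq.iota 0 r].
Proof.
move=> yr; apply: prod_XsubC_perm.
by rewrite big_map -conj_rootsE ?orbit_poly_monic // orbit_polyE // /index_iota subn0.
Qed.

(** The elements of the extension of degree r of F inside K. *)
Definition frob_fixed r : seq K :=
  sval (closed_field_poly_normal ('X^(#|F| ^ r) - 'X : {poly K})).

Lemma frob_fixed_prod r : (0 < r)%N ->
  'X^(#|F| ^ r) - 'X = \prod_(y <- frob_fixed r) ('X - y%:P) :> {poly K}.
Proof.
move=> r0; rewrite /frob_fixed; case: (closed_field_poly_normal _) => s /= {1}->.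
rewrite lead_coefDl ?lead_coefXn ?scale1r //.
rewrite size_polyXn size_polyN size_polyX ltnS.
case: r r0 => // r _; rewrite expnS (leq_trans (finNzRing_gt1 F)) //.
by rewrite leq_pmulr // expn_gt0 (card_finField_gt0 F).
Qed.

Lemma mem_frob_fixed r y : (0 < r)%N ->
  (y \in frob_fixed r) = (iter r (frob iota) y == y).
Proof.
move=> r0; rewrite -root_prod_XsubC -frob_fixed_prod // iter_frobE.
by rewrite /root !hornerE subr_eq0.
Qed.

Lemma frob_fixed_uniq r : (0 < r)%N -> uniq (frob_fixed r).
Proof.
move=> r0; rewrite -separable_prod_XsubC -frob_fixed_prod //.
have q0 : #|F|%:R = 0 :> K.
  by rewrite -(rmorph_nat iota) natr_card_finField rmorph0.
rewrite unlock derivB derivXn derivX -scaler_nat natrX q0 expr0n gtn_eqF //.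
rewrite scale0r sub0r -(scaleN1r 1) coprimepZr ?oppr_eq0 ?oner_eq0 //.
exact: coprimep1.
Qed.

Fixpoint monics n : seq {poly F} :=
  if n is m.+1 then [seq 'X * f + a%:P | f <- monics m, a <- enum F] else [:: 1].

Lemma mem_monics n f : (f \in monics n) = (f \is monic) && (size f == n.+1).
Proof.
elim: n f => [|n IH] f.
  rewrite inE; apply/eqP/andP => [->|[mf /eqP sf]]; first by rewrite monic1 size_poly1.
  have /size1_polyC fE : (size f <= 1)%N by rewrite sf.
  move: mf; rewrite fE monicE lead_coefC => /eqP e; by rewrite e.
apply/allpairsP/andP => [[[g a] /= [gM _ ->]]|[mf /eqP sf]].
  move: gM; rewrite IH => /andP[mg /eqP sg].
  have g0 : size ('X * g) = n.+2 by rewrite size_monicM ?monicX ?monic_neq0 // size_polyX sg.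
  have sa : (size (a%:P : {poly F}) < size ('X * g)%R)%N.
    by rewrite g0 (leq_ltn_trans (size_polyC_leq1 a)).
  by rewrite monicE lead_coefDl // size_polyDl // g0 lead_coefM lead_coefX mul1r -monicE.
exists (f %/ 'X, f`_0) => /=.
have fE : f = 'X * (f %/ 'X) + (f`_0)%:P.
  rewrite {1}(divp_eq f 'X) mulrC; congr (_ + _).
  by rewrite -['X]subr0 modp_XsubC horner_coef0.
rewrite mem_enum; split => //; rewrite IH.
have g0 : f %/ 'X != 0.
  apply: contra_eqN sf => /eqP g0; rewrite fE g0 mulr0 add0r.
  by rewrite neq_ltn (leq_ltn_trans (size_polyC_leq1 _)).
have szX : size ('X * (f %/ 'X)) = (size (f %/ 'X)).+1.
  by rewrite size_monicM ?monicX // size_polyX.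
have sa : (size ((f`_0)%:P : {poly F}) < size ('X * (f %/ 'X))%R)%N.
  by rewrite szX ltnS (leq_trans (size_polyC_leq1 _)) // size_poly_gt0.
move: mf sf; rewrite {1 2}fE monicE lead_coefDl // size_polyDl // szX.
by rewrite lead_coefM lead_coefX mul1r -monicE => -> [->]; rewrite eqxx.
Qed.

Lemma monics_uniq n : uniq (monics n).
Proof.
elim: n => //= n IH; apply: allpairs_uniq => //; first exact: enum_uniq.
move=> [f a] [g b] _ _ /= e.
have ab : a = b.
  by have := congr1 (fun p => p.[0]) e; rewrite !hornerE.
by move: e; rewrite ab => /addIr/(mulfI (monic_neq0 (monicX F))) ->.
Qed.

Lemma sum_count_undup (T : eqType) (s : seq T) :
  (\sum_(x <- undup s) count_mem x s = size s)%N.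
Proof.
rewrite -[RHS](perm_size (perm_count_undup s)) size_flatten /shape -map_comp.
by rewrite sumnE big_map; apply: eq_bigr => x _; rewrite /= size_nseq.
Qed.

(** Exchanging the sums gives the total multiplicity of the roots of f. *)
Lemma orbit_count f : f \is monic ->
  (\sum_(1 <= r < size f) \sum_(y <- frob_fixed r) (orbit_poly iota r y %| f)%R =
   (size f).-1)%N.
Proof.
move=> mf; have rfE := conj_rootsE mf.
rewrite size_conj_roots //= -[RHS]sum_count_undup.
under [RHS]eq_bigr => y _ do
  rewrite -mu_prod_XsubC -rfE -orbit_count_at // (size_conj_roots mf).
rewrite exchange_big /=; apply: eq_big_nat => r /andP[r0 _].
have sum_count (T : Type) (t : seq T) (b : pred T) : (\sum_(x <- t) b x = count b t)%N.
  by rewrite -sum1_count [RHS]big_mkcond; apply: eq_bigr => x _; case: (b x).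
rewrite !sum_count -!size_filter; apply/perm_size/uniq_perm.
- by rewrite filter_uniq ?frob_fixed_uniq.
- by rewrite filter_uniq ?undup_uniq.
move=> y; rewrite !mem_filter mem_undup mem_frob_fixed //.
case: (eqVneq (iter _ _ _) y) => /= yr; rewrite ?andbF //.
case: (boolP (_ %| _)) => D; rewrite ?andbF ?andbT //; apply/esym.
rewrite -root_prod_XsubC -rfE; rewrite -(dvdp_map iota) in D.
exact/(root_dvdp D)/root_orbit_poly.
Qed.

Section MultiplicativeFunction.
Variables (C : comPzRingType) (h : {poly F} -> C).
Hypothesis hM : forall f g, f \is monic -> g \is monic -> h (f * g) = h f * h g.

Definition monic_sum n : C := \sum_(f <- monics n) h f.
Definition orbit_sum r : C := \sum_(y <- frob_fixed r) h (orbit_poly iota r y).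

Lemma monic_sum_dvd n r (p : {poly F}) : p \is monic -> size p = r.+1 -> (r <= n)%N ->
  \sum_(f <- monics n | p %| f) h f = h p * monic_sum (n - r).
Proof.
move=> mp sp rn; rewrite -big_filter /monic_sum big_distrr /=.
have -> : \sum_(f <- monics (n - r)) h p * h f =
          \sum_(f <- [seq p * f | f <- monics (n - r)]) h f.
  rewrite big_map big_seq [RHS]big_seq; apply: eq_bigr => f.
  by rewrite mem_monics => /andP[mf _]; rewrite hM.
apply: perm_big; apply: uniq_perm; first by rewrite filter_uniq ?monics_uniq.
  by rewrite map_inj_uniq ?monics_uniq //; move=> f g /(mulfI (monic_neq0 mp)).
have szM g : g \is monic -> size (p * g) = (r + size g)%N.
  by move=> mg; rewrite size_monicM ?monic_neq0 // sp.
move=> f; rewrite mem_filter mem_monics; apply/andP/mapP.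
  move=> [/dvdpP[g ->] /andP[]]; rewrite mulrC monicMl // => mg.
  rewrite szM // => /eqP e; exists g => //.
  by rewrite mem_monics mg -(eqn_add2l r) e addnS subnKC ?eqxx.
move=> [g]; rewrite mem_monics => /andP[mg /eqP sg] ->.
by rewrite dvdp_mulr // monicMl // mg szM // sg addnS subnKC ?eqxx.
Qed.

(** The weight n of each f is written as the number of pairs (r, y) with
orbit_poly r y dividing f; the polynomials divisible by a given P then
contribute h P times a sum over the quotients.  This is the logarithmic
derivative of the Euler product of h. *)
Lemma monic_sum_recurrence n :
  n%:R * monic_sum n = \sum_(1 <= r < n.+1) orbit_sum r * monic_sum (n - r).
Proof.
transitivity (\sum_(f <- monics n) \sum_(1 <= r < n.+1)
    \sum_(y <- frob_fixed r | orbit_poly iota r y %| f) h f).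
  rewrite big_distrr /= big_seq [RHS]big_seq; apply: eq_bigr => f.
  rewrite mem_monics => /andP[mf /eqP sf].
  have := orbit_count mf; rewrite sf /= => e; rewrite -{1}e.
  rewrite natr_sum big_distrl /=; apply: eq_bigr => r _.
  rewrite natr_sum big_distrl /= [RHS]big_mkcond; apply: eq_bigr => y _.
  by case: ifP; rewrite ?mul1r ?mul0r.
rewrite exchange_big /=; apply: eq_big_nat => r /andP[r0 rn].
under eq_bigr do rewrite big_mkcond.
rewrite exchange_big /= big_distrl /= big_seq [RHS]big_seq; apply: eq_bigr => y.
rewrite mem_frob_fixed // => /eqP yr.
by rewrite -big_mkcond (@monic_sum_dvd n r) ?orbit_poly_monic ?size_orbit_poly.
Qed.
End MultiplicativeFunction.

End OrbitRecurrence.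

(** * Newton's identities *)

Section Newton.
Variable C : comNzRingType.

Definition elem_poly (s : seq C) : {poly C} := \prod_(g <- s) (1 + g *: 'X).

(** The logarithmic derivative of prod (1 + g X), truncated: each factor
contributes g / (1 + g X) = sum_i g (- g X)^i. *)
Lemma newton_recurrence (s : seq C) n :
  n.+1%:R * (elem_poly s)`_n.+1 =
  \sum_(i < n.+1) (\sum_(g <- s) g * (- g) ^+ i) * (elem_poly s)`_(n - i).
Proof.
(* T is the logarithmic derivative modulo X^(n + 1). *)
pose T (s : seq C) : {poly C} := \sum_(g <- s) g *: \sum_(i < n.+1) (- (g *: 'X)) ^+ i.
have coefT i : (i < n.+1)%N -> (T s)`_i = \sum_(g <- s) g * (- g) ^+ i.
  move=> lt_in; rewrite coef_sum; apply: eq_bigr => g _; rewrite coefZ; congr (_ * _).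
  rewrite coef_sum (bigD1 (Ordinal lt_in)) //= big1 ?addr0 => [|j ne_ji].
    by rewrite -scaleNr exprZn coefZ coefXn eqxx mulr1.
  rewrite -scaleNr exprZn coefZ coefXn; case: eqP => [e|]; last by rewrite mulr0.
  by case/eqP: ne_ji; apply/val_inj.
have [R TE] : exists R, (elem_poly s)^`() = T s * elem_poly s + 'X^(n.+1) * R.
  rewrite /T /elem_poly {coefT}; elim: s => [|g s [R IH]].
    by exists 0; rewrite !big_nil derivC mul0r mulr0 addr0.
  rewrite !big_cons derivM IH derivD derivC add0r derivZ derivX.
  set A := \prod_(_ <- _) _; set t := \sum_(_ <- _) _; set u := \sum_(_ < _) _.
  have uE : (1 + g *: 'X) * u = 1 - (- (g *: 'X)) ^+ n.+1.
    have := subrX1 (- (g *: 'X) : {poly C}) n.+1; rewrite -/u => e.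
    by rewrite -[RHS]opprB e -mulNr opprB opprK.
  exists ((1 + g *: 'X) * R + (g * (- g) ^+ n.+1) *: A).
  have -> : g *: 1 * A = (g *: u) * ((1 + g *: 'X) * A) +
      'X^(n.+1) * ((g * (- g) ^+ n.+1) *: A).
    rewrite mulrA -[(g *: u) * _]scalerAl [u * _]mulrC uE -scaleNr exprZn.
    by rewrite -!mul_polyC polyCM; ring.
  by ring.
rewrite mulr_natl -coef_deriv TE coefD coefXnM ltnSn addr0 coefM.
by apply: eq_bigr => i _; rewrite coefT.
Qed.

Definition power_sum (s : seq C) k : C := \sum_(y <- s) y ^+ k.

Lemma elem_poly0 s : (elem_poly s)`_0 = 1.
Proof.
rewrite -horner_coef0 horner_prod big1_seq // => g _.
by rewrite !hornerE.
Qed.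

(** Both coefficients are the j-th elementary symmetric function of s. *)
Lemma elem_poly_rev s j : (j <= size s)%N ->
  (elem_poly s)`_j = (\prod_(g <- s) ('X + g%:P))`_(size s - j).
Proof.
rewrite /elem_poly; elim: s j => [|g s IH] j; rewrite ?big_nil ?big_cons.
  by case: j.
rewrite mulrDl mul1r -scalerAl coefD coefZ coefXM mulrDl coefD coefXM coefCM /=.
have szA : (size (\prod_(h <- s) (1 + h *: 'X))%R <= (size s).+1)%N.
  elim: (s) => [|h s' IHs]; rewrite ?big_nil ?big_cons ?size_poly1 //.
  rewrite mulrDl mul1r -scalerAl (leq_trans (size_polyD _ _)) // geq_max.
  rewrite (leq_trans IHs) //= (leq_trans (size_scale_leq _ _)) //.
  by rewrite mulrC; apply: leq_trans (size_polyMleq _ _) _; rewrite size_polyX addn2 ltnS.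
case: j => [_|j]; rewrite ?subSS ?subn0 /=.
  have szB : (size (\prod_(h <- s) ('X + h%:P))%R <= (size s).+1)%N.
    elim: (s) => [|h s' IHs]; rewrite ?big_nil ?big_cons ?size_poly1 //.
    rewrite (leq_trans (size_polyMleq _ _)) // size_XaddC addSn /= ltnS //.
  by rewrite (IH 0%N) // subn0 [_`_(size s).+1]nth_default // !mulr0.
rewrite ltnS => le_js; rewrite (IH j) //.
have [e|ne] := eqVneq j (size s).
  by rewrite e subnn /= [_`_(size s).+1]nth_default.
have lt_js : (j < size s)%N by rewrite ltn_neqAle ne.
by rewrite (IH j.+1) // subn_eq0 leqNgt lt_js /= subnS.
Qed.

Lemma elem_poly_size s : (elem_poly s)`_(size s) = \prod_(g <- s) g.
Proof.
rewrite elem_poly_rev // subnn -horner_coef0 horner_prod.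
by apply: eq_bigr => g _; rewrite !hornerE.
Qed.

Lemma power_sum_elem (s : seq C) k :
  power_sum s k.+1 = - k.+1%:R * (elem_poly (map -%R s))`_k.+1
    - \sum_(i < k) power_sum s i.+1 * (elem_poly (map -%R s))`_(k - i).
Proof.
rewrite mulNr newton_recurrence -opprD big_ord_recr /= subnn elem_poly0 mulr1.
have e i : \sum_(g <- map -%R s) g * (- g) ^+ i = - power_sum s i.+1.
  rewrite big_map -sumrN; apply: eq_bigr => y _.
  by rewrite opprK mulNr exprS.
rewrite e; under eq_bigr do rewrite e mulNr.
by rewrite sumrN; ring.
Qed.

Lemma power_sum_congr (s s' : seq C) k :
  (forall j, (j <= k)%N -> (elem_poly (map -%R s))`_j = (elem_poly (map -%R s'))`_j) ->
  forall j, (j < k)%N -> power_sum s j.+1 = power_sum s' j.+1.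
Proof.
move=> eA; elim/ltn_ind => j IH lt_jk; rewrite !power_sum_elem eA //.
congr (_ - _); apply: eq_bigr => i _.
rewrite IH // ?(ltn_trans _ lt_jk) // eA //.
by rewrite (leq_trans (leq_subr _ _)) // ltnW.
Qed.

(** By Newton's identities p_(k + 1) + (k + 1) e, where e is the last
coefficient, is a function of the preceding coefficients. *)
Lemma power_sum_change_last (s s' : seq C) k :
  (forall j, (j <= k)%N -> (elem_poly (map -%R s))`_j = (elem_poly (map -%R s'))`_j) ->
  power_sum s k.+1 + k.+1%:R * (elem_poly (map -%R s))`_k.+1 =
  power_sum s' k.+1 + k.+1%:R * (elem_poly (map -%R s'))`_k.+1.
Proof.
move=> eA; rewrite !power_sum_elem.
have -> : \sum_(i < k) power_sum s i.+1 * (elem_poly (map -%R s))`_(k - i) =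
          \sum_(i < k) power_sum s' i.+1 * (elem_poly (map -%R s'))`_(k - i).
  apply: eq_bigr => i _; rewrite (power_sum_congr eA) // eA //.
  by rewrite leq_subr.
by ring.
Qed.
End Newton.

(** * Gauss sums and the product formula of Hasse and Davenport *)

Lemma natr_coprime_neq0 (F : finFieldType) k : coprime #|F| k -> k%:R != 0 :> F.
Proof.
move=> /coprimeP; rewrite card_finField_gt0 => /(_ isT)[[u v] /= uv].
have e : (u * #|F| = 1 + v * k)%N.
  by rewrite -uv subnK // ltnW // -subn_gt0 uv.
have := congr1 (fun n => n%:R : F) e.
rewrite natrM natr_card_finField mulr0 natrD natrM => /esym/eqP.
by apply: contraTneq => ->; rewrite mulr0 addr0 oner_eq0.
Qed.

Lemma prod_expz (K : fieldType) (I : Type) (r : seq I) (P : pred I) (x : K) (f : I -> int) :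
  x != 0 -> \prod_(i <- r | P i) x ^ f i = x ^ (\sum_(i <- r | P i) f i).
Proof.
move=> x0; rewrite (big_morph (fun z => x ^ z) (id1 := 1) (op1 := *%R)) //.
by move=> a b; rewrite expfzDr.
Qed.

Section CharacterSums.
Variables (F : finFieldType) (C : numFieldType) (psi chi : F -> C).
Hypothesis psi0 : psi 0 = 1.
Hypothesis psiD : forall x y, psi (x + y) = psi x * psi y.
Hypothesis psi_nt : exists x, psi x <> 1.
Hypothesis chi1 : chi 1 = 1.
Hypothesis chiM : forall x y, x != 0 -> y != 0 -> chi (x * y) = chi x * chi y.
Hypothesis chi_inj : forall x, x != 0 -> chi x = 1 -> x = 1.

(** The sum gauss_sum, for characters with values in any numFieldType. *)
Definition gauss (c : int) : C := \sum_(u : F | u != 0) psi u * chi u ^ c.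

Lemma chi_neq0 x : x != 0 -> chi x != 0.
Proof.
move=> x0; apply/eqP => e; have /eqP := chi1.
by rewrite -(mulfV x0) chiM ?invr_eq0 // e mul0r eq_sym oner_eq0.
Qed.

Lemma chiX x n : x != 0 -> chi (x ^+ n) = chi x ^+ n.
Proof.
by move=> x0; elim: n => [|n IH]; rewrite ?expr0 // !exprS chiM ?expf_neq0 ?IH.
Qed.

Lemma chiV x : x != 0 -> chi x^-1 = (chi x)^-1.
Proof.
move=> x0; apply: (mulfI (chi_neq0 x0)).
by rewrite -chiM ?invr_eq0 // !mulfV ?chi_neq0.
Qed.

Lemma sum_psi : \sum_(x : F) psi x = 0.
Proof.
have [a pa] := psi_nt; have : \sum_(x : F) psi x = psi a * \sum_(x : F) psi x.
  rewrite [LHS](reindex_inj (addrI a)) /= big_distrr /=; apply: eq_bigr => x _.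
  by rewrite psiD.
move/eqP; rewrite -subr_eq0 -{1}[\sum_x _]mul1r -mulrBl mulf_eq0 subr_eq0.
by case/orP => /eqP // e; case: pa.
Qed.

(** The character chi^c, extended by 0 to a multiplicative function on F. *)
Definition chi0 (c : int) (x : F) : C := if x == 0 then 0 else chi x ^ c.

Lemma chi0M c x y : chi0 c (x * y) = chi0 c x * chi0 c y.
Proof.
rewrite /chi0 mulf_eq0; case: eqVneq => x0; rewrite ?mul0r //=.
by case: eqVneq => y0; rewrite ?mulr0 // chiM // expfzMl.
Qed.

Lemma chi0X c x n : (0 < n)%N -> chi0 c (x ^+ n) = chi0 (n%:Z * c) x.
Proof.
move=> n0; rewrite /chi0 expf_eq0 n0 /=; case: eqVneq => // x0.
by rewrite chiX // exprnP -exprz_exp.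
Qed.

Section Extension.
Variables (K : closedFieldType) (iota : {rmorphism F -> K}).
Local Notation frob := (frob iota).
Local Notation descend := (descend iota).
Local Notation conj_roots := (conj_roots iota).
Local Notation monics := (monics F).

Lemma descendD x y : frob x = x -> frob y = y -> descend (x + y) = descend x + descend y.
Proof.
move=> fx fy; apply: (fmorph_inj iota).
by rewrite rmorphD /= !descendK // rmorphD /= fx fy.
Qed.

Lemma descendM x y : frob x = x -> frob y = y -> descend (x * y) = descend x * descend y.
Proof.
move=> fx fy; apply: (fmorph_inj iota).
by rewrite rmorphM /= !descendK // rmorphM /= fx fy.
Qed.

Lemma descendX x n : frob x = x -> descend (x ^+ n) = descend x ^+ n.
Proof.
move=> fx; apply: (fmorph_inj iota).
by rewrite rmorphXn /= !descendK // rmorphXn /= fx.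
Qed.

Lemma descend0 : descend 0 = 0.
Proof. by rewrite -(rmorph0 iota) rmorph_descend. Qed.

Lemma descend1 : descend 1 = 1.
Proof. by rewrite -(rmorph1 iota) rmorph_descend. Qed.

Lemma perm_frob_conj_roots f : f \is monic ->
  perm_eq (map frob (conj_roots f)) (conj_roots f).
Proof.
move=> mf; apply: prod_XsubC_perm; rewrite big_map -map_prod_XsubC -conj_rootsE //.
by apply/polyP => j; rewrite !coef_map /= frob_rmorph.
Qed.

Lemma frob_power_sum f l : f \is monic ->
  frob (power_sum (conj_roots f) l) = power_sum (conj_roots f) l.
Proof.
move=> mf; rewrite rmorph_sum /= /power_sum -[RHS](perm_big _ (perm_frob_conj_roots mf)).
by rewrite big_map; apply: eq_bigr => y _; rewrite rmorphXn.
Qed.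

Lemma frob_prod_roots f : f \is monic ->
  frob (\prod_(y <- conj_roots f) y) = \prod_(y <- conj_roots f) y.
Proof.
move=> mf; rewrite rmorph_prod /= -[RHS](perm_big _ (perm_frob_conj_roots mf)).
by rewrite big_map.
Qed.

(** With l = 1 this is the function psi(trace) chi^c(norm), and for
arbitrary l its composition with the map that raises all roots to the power l,
up to the exponent of chi. *)
Definition root_weight l c (f : {poly F}) : C :=
  psi (descend (power_sum (conj_roots f) l)) *
  chi0 c (descend (\prod_(y <- conj_roots f) y)).

Lemma root_weightM l c f g : f \is monic -> g \is monic ->
  root_weight l c (f * g) = root_weight l c f * root_weight l c g.
Proof.
move=> mf mg; rewrite /root_weight /power_sum.
rewrite !(perm_big _ (conj_roots_mul iota mf mg)) !big_cat /=.
rewrite descendD ?frob_power_sum // descendM ?frob_prod_roots //.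
by rewrite psiD chi0M mulrACA.
Qed.

Lemma conj_roots1 : conj_roots 1 = [::].
Proof.
by apply/nilP; rewrite /nilp -eqSS -size_conj_roots ?monic1 // size_poly1.
Qed.

Lemma root_weight1 l c : root_weight l c 1 = 1.
Proof.
rewrite /root_weight /power_sum conj_roots1 !big_nil descend0 descend1 psi0 mul1r.
by rewrite /chi0 oner_eq0 chi1 exp1rz.
Qed.

Definition orbit_trace r x : K := \sum_(0 <= i < r) iter i frob x.
Definition orbit_norm r x : K := \prod_(0 <= i < r) iter i frob x.

(** The additive and multiplicative characters of the extension of degree r
obtained from psi and chi^c by composition with the trace and the norm. *)
Definition field_weight c r x : C := psi (descend (orbit_trace r x)) * chi0 c (descend (orbit_norm r x)).

Lemma iter_frobX i (x : K) n : iter i frob (x ^+ n) = iter i frob x ^+ n.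
Proof. by rewrite !iter_frobE -!exprM mulnC. Qed.

Lemma frob_orbit_norm r x : iter r frob x = x -> frob (orbit_norm r x) = orbit_norm r x.
Proof.
move=> xr; rewrite /orbit_norm rmorph_prod /=; case: r xr => [|r] xr; first by rewrite !big_nil.
by rewrite big_nat_recr //= big_nat_recl //= mulrC -iterS xr.
Qed.

Lemma orbit_normX r x n : orbit_norm r (x ^+ n) = orbit_norm r x ^+ n.
Proof. by rewrite /orbit_norm -prodrXl; apply: eq_bigr => i _; rewrite iter_frobX. Qed.

Lemma root_weight_orbit l c r y : iter r frob y = y ->
  root_weight l c (orbit_poly iota r y) =
  psi (descend (orbit_trace r (y ^+ l))) * chi0 c (descend (orbit_norm r y)).
Proof.
move=> yr; rewrite /root_weight /power_sum !(perm_big _ (conj_roots_orbit yr)) !big_map.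
rewrite /orbit_trace /orbit_norm /index_iota subn0; congr (psi (descend _) * _).
by apply: eq_bigr => i _; rewrite iter_frobX.
Qed.

Local Notation orbit_sum := (orbit_sum iota).

Lemma orbit_sum_weight1 c r : (0 < r)%N ->
  orbit_sum (root_weight 1 c) r = \sum_(x <- frob_fixed F K r) field_weight c r x.
Proof.
move=> r0; rewrite /orbit_sum big_seq [RHS]big_seq; apply: eq_bigr => x.
by rewrite (mem_frob_fixed iota) // => /eqP xr; rewrite root_weight_orbit // expr1.
Qed.

Lemma orbit_sum_weight_power l c r : (0 < l)%N -> (0 < r)%N ->
  orbit_sum (root_weight l (l%:Z * c)) r =
  \sum_(y <- frob_fixed F K r) field_weight c r (y ^+ l).
Proof.
move=> l0 r0; rewrite /orbit_sum big_seq [RHS]big_seq; apply: eq_bigr => x.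
rewrite (mem_frob_fixed iota) // => /eqP xr; rewrite root_weight_orbit //.
by rewrite /field_weight orbit_normX descendX ?frob_orbit_norm // chi0X.
Qed.

Lemma orbit_normE r x : orbit_norm r x = x ^+ (\sum_(i < r) #|F| ^ i)%N.
Proof.
rewrite /orbit_norm big_mkord -prodrXr; apply: eq_bigr => i _.
by rewrite iter_frobE.
Qed.

Lemma natr_predq_neq0 l : (l %| #|F|.-1)%N -> l%:R != 0 :> F.
Proof.
move=> /dvdnP[e qE]; apply/eqP => l0.
have := congr1 (fun k => k%:R : F) (esym qE); rewrite natrM l0 mulr0 => /esym.
suff -> : #|F|.-1%:R = -1 :> F by move/eqP; rewrite oppr_eq0 oner_eq0.
apply/eqP; rewrite -addr_eq0 natr1 prednK ?card_finField_gt0 //.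
by rewrite natr_card_finField.
Qed.

(** The multiplicative group of the extension is the group of roots of unity
of order l e G with G = 1 + q + ... + q^(r - 1), and the norm is x |-> x^G.  So
x is an l-th power exactly when x^(e G) = 1, and then all its l roots of order l
lie in the extension. *)
Lemma count_roots_fixed (l e r : nat) (x : K) : #|F|.-1 = (l * e)%N -> (0 < l)%N ->
  (0 < r)%N -> x != 0 ->
  count (fun y => y ^+ l == x) (frob_fixed F K r) =
  if orbit_norm r x ^+ e == 1 then l else 0%N.
Proof.
move=> qE l0 r0 x0; set G := (\sum_(i < r) #|F| ^ i)%N.
have qrE : (#|F| ^ r).-1 = (l * e * G)%N by rewrite predn_exp qE.
have fixE z : z != 0 -> (z \in frob_fixed F K r) = (z ^+ (l * e * G) == 1).
  move=> z0; rewrite (mem_frob_fixed iota) // iter_frobE.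
  rewrite -[(#|F| ^ r)%N]prednK ?expn_gt0 ?card_finField_gt0 // exprS qrE.
  by rewrite -[X in _ == X]mulr1 (inj_eq (mulfI z0)).
have powE z : z ^+ (l * e * G) = orbit_norm r (z ^+ l) ^+ e.
  by rewrite orbit_normE -/G -!exprM mulnAC.
have y_neq0 y : y ^+ l = x -> y != 0.
  by move=> yl; apply: contraNneq x0 => y0; rewrite -yl y0 expr0n gtn_eqF.
case: eqP => nx; last first.
  apply/eqP; rewrite -leqn0 leqNgt -has_count; apply/hasPn => y yF.
  apply/eqP => yl; apply: nx; rewrite -yl -powE; apply/eqP.
  by rewrite -fixE ?y_neq0.
have [s sE] := closed_field_poly_normal ('X^l - x%:P : {poly K}).
rewrite lead_coefDl ?lead_coefXn ?scale1r in sE; last first.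
  by rewrite size_polyXn size_polyN (leq_ltn_trans (size_polyC_leq1 _)).
have mem_s y : (y \in s) = (y ^+ l == x).
  by rewrite -root_prod_XsubC -sE /root !hornerE subr_eq0.
(* The roots are distinct because l, a divisor of q - 1, is invertible. *)
have ll : l%:R != 0 :> K.
  by rewrite -(rmorph_nat iota) fmorph_eq0 natr_predq_neq0 // qE dvdn_mulr.
have uniq_s : uniq s.
  rewrite -separable_prod_XsubC -sE unlock derivB derivXn derivC subr0.
  rewrite -scaler_nat coprimepZr // coprimep_expr //.
  have := coprimep_XsubC ('X^l - x%:P) 0; rewrite subr0 => ->.
  by rewrite /root !hornerE expr0n gtn_eqF // sub0r oppr_eq0.
rewrite -size_filter.
have szs : l = size s.
  by apply/succn_inj; rewrite -(size_prod_XsubC s id) -sE size_XnsubC.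
rewrite [RHS]szs; apply/perm_size/uniq_perm; rewrite ?filter_uniq ?(frob_fixed_uniq iota) //.
move=> y; rewrite mem_filter mem_s; case: eqP => //= yl.
by rewrite (fixE _ (y_neq0 _ yl)) powE yl nx eqxx.
Qed.

Lemma field_weight_shift c (l e i r : nat) x : #|F|.-1 = (l * e)%N ->
  field_weight (c + (i * e)%N%:Z) r x =
  field_weight c r x * (chi (descend (orbit_norm r x)) ^+ e) ^+ i.
Proof.
move=> qE; rewrite /field_weight -mulrA /chi0; congr (_ * _).
case: eqVneq => w0; first by rewrite mul0r.
by rewrite expfzDr ?chi_neq0 // -exprM mulnC.
Qed.

(** The number of l-th roots of x is the sum over i < l of chi^(i e) at the
norm of x, by orthogonality of the characters of order dividing l. *)
Lemma sum_field_weight_power c r (l e : nat) : #|F|.-1 = (l * e)%N -> (0 < l)%N ->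
  (0 < r)%N ->
  \sum_(y <- frob_fixed F K r) field_weight c r (y ^+ l) =
  \sum_(i < l) \sum_(x <- frob_fixed F K r) field_weight (c + (i * e)%N%:Z) r x.
Proof.
move=> qE l0 r0.
transitivity (\sum_(y <- frob_fixed F K r) \sum_(x <- frob_fixed F K r | y ^+ l == x)
                field_weight c r x).
  rewrite big_seq [RHS]big_seq; apply: eq_bigr => y yF.
  rewrite -big_filter (perm_big [:: y ^+ l]) ?big_seq1 //.
  apply: uniq_perm; rewrite ?filter_uniq ?(frob_fixed_uniq iota) // => x.
  rewrite mem_filter inE [_ == x]eq_sym; case: eqP => //= ->.
  move: yF; rewrite !(mem_frob_fixed iota) // => /eqP yr.
  by rewrite iter_frobX yr eqxx.
under eq_bigr do rewrite big_mkcond.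
rewrite [LHS]exchange_big [RHS]exchange_big /= big_seq [RHS]big_seq.
apply: eq_bigr => x xF.
under [RHS]eq_bigr do rewrite (field_weight_shift _ _ _ _ qE).
rewrite -big_mkcond big_const_seq iter_addr_0 -big_distrr /=.
have xr : iter r frob x = x by apply/eqP; rewrite -(mem_frob_fixed iota).
set w := descend (orbit_norm r x); have wE : iota w = orbit_norm r x by rewrite descendK ?frob_orbit_norm.
have [x0|x0] := eqVneq x 0.
  have -> : field_weight c r x = 0; last by rewrite mul0rn mul0r.
  rewrite /field_weight /chi0 ifT ?mulr0 //.
  rewrite -(fmorph_eq0 iota) wE x0 /orbit_norm.
  by case: r r0 {xF xr w wE} => // r _; rewrite big_nat_recl //= mul0r.
have w0 : w != 0 by rewrite -(fmorph_eq0 iota) wE orbit_normE expf_neq0.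
rewrite -[LHS]mulr_natr; congr (_ * _); rewrite (count_roots_fixed qE) // -wE.
rewrite -rmorphXn -(rmorph1 iota) (inj_eq (fmorph_inj iota)).
set z := chi w ^+ e.
have zl : z ^+ l = 1.
  by rewrite /z -exprM -chiX // mulnC -qE -[w ^+ _]mul1r -(mulVf w0) -mulrA -exprS prednK
    ?card_finField_gt0 // expf_card mulVf.
case: (eqVneq (w ^+ e) 1) => we.
  have -> : z = 1 by rewrite /z -chiX // we.
  by under eq_bigr do rewrite expr1n; rewrite sumr_const card_ord.
have z1 : z - 1 != 0.
  rewrite subr_eq0; apply: contraNneq we => ze; apply/eqP.
  by apply: chi_inj; rewrite ?expf_neq0 // chiX.
by apply: (mulfI z1); rewrite -subrX1 zl subrr mulr0.
Qed.

Local Notation msum := (monic_sum (F := F)).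

Lemma sum_conj_roots f n : f \is monic -> size f = n.+2 ->
  iota f`_n = - \sum_(y <- conj_roots f) y.
Proof.
move=> mf sf; have szr : size (conj_roots f) = n.+1.
  by apply/succn_inj; rewrite -size_conj_roots.
by rewrite -coef_map conj_rootsE // -coefPn_prod_XsubC szr.
Qed.

Lemma prod_conj_roots f n : f \is monic -> size f = n.+1 ->
  iota f`_0 = (-1) ^+ n * \prod_(y <- conj_roots f) y.
Proof.
move=> mf sf; have szr : size (conj_roots f) = n.
  by apply/succn_inj; rewrite -size_conj_roots.
by rewrite -coef_map conj_rootsE // coef0_prod_XsubC szr.
Qed.

Lemma descend_prod_conj_roots f n : f \is monic -> size f = n.+1 ->
  descend (\prod_(y <- conj_roots f) y) = (-1) ^+ n * f`_0.
Proof.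
move=> mf sf; apply: (fmorph_inj iota); rewrite descendK ?frob_prod_roots //.
by rewrite rmorphM /= (prod_conj_roots mf sf) rmorph_sign signrMK.
Qed.

Lemma root_weight1E c f n : f \is monic -> size f = n.+2 ->
  root_weight 1 c f = psi (- f`_n) * chi0 c ((-1) ^+ n.+1 * f`_0).
Proof.
move=> mf sf; rewrite /root_weight -(descend_prod_conj_roots mf sf).
congr (psi _ * _); apply: (fmorph_inj iota); rewrite descendK ?frob_power_sum //.
rewrite rmorphN /= (sum_conj_roots mf sf) opprK.
by apply: eq_bigr => y _; rewrite expr1.
Qed.

Lemma monic_sum_weight0 l c : msum (root_weight l c) 0 = 1.
Proof. by rewrite /monic_sum big_seq1 root_weight1. Qed.

Lemma monic_sum_weight1 c : msum (root_weight 1 c) 1 = gauss c.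
Proof.
rewrite /monic_sum /= cats0 big_map big_enum /gauss /=.
rewrite (reindex_inj oppr_inj) /= [RHS]big_mkcond /=; apply: eq_bigr => u _.
have XuE : 'X * 1 + (- u)%:P = 'X - u%:P :> {poly F} by rewrite mulr1 polyCN.
rewrite XuE (@root_weight1E c _ 0) ?monicXsubC ?size_XsubC //.
rewrite coefB coefX coefC sub0r opprK expr1 mulN1r opprK /chi0.
by case: (u == 0); rewrite ?mulr0.
Qed.

(** Translating f by a multiple of X^(n - 1) changes the sum of the roots and
not their product when n > 1, so psi sums to zero. *)
Lemma monic_sum_weight_big c n : (1 < n)%N -> msum (root_weight 1 c) n = 0.
Proof.
case: n => [|[|n]] // _; have [b pb] := psi_nt.
pose sh (f : {poly F}) := f - b *: 'X^(n.+1).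
have szb f : size f = n.+3 -> (size (- (b *: 'X^(n.+1))) < size f)%N.
  by move=> ->; rewrite size_polyN (leq_ltn_trans (size_scale_leq _ _)) ?size_polyXn.
have mem_sh f : f \in monics n.+2 -> sh f \in monics n.+2.
  rewrite !mem_monics => /andP[mf /eqP sf].
  by rewrite monicE lead_coefDl ?szb // -monicE mf size_polyDl ?szb // sf eqxx.
have sh_inj : injective sh by move=> f g /addIr.
have perm_sh : perm_eq (map sh (monics n.+2)) (monics n.+2).
  have u : uniq (map sh (monics n.+2)) by rewrite map_inj_uniq ?monics_uniq.
  have sub : {subset map sh (monics n.+2) <= monics n.+2}.
    by move=> _ /mapP[f fM ->]; apply: mem_sh.
  have [_ e] := uniq_min_size u sub (eq_leq (esym (size_map _ _))).
  by apply: uniq_perm; rewrite ?monics_uniq.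
have : msum (root_weight 1 c) n.+2 = psi b * msum (root_weight 1 c) n.+2.
  rewrite {1}/monic_sum -(perm_big _ perm_sh) big_map big_distrr.
  rewrite big_seq [RHS]big_seq; apply: eq_bigr => f fM.
  have /andP[ms /eqP ss] : (sh f \is monic) && (size (sh f) == n.+3).
    by rewrite -mem_monics mem_sh.
  move: fM; rewrite mem_monics => /andP[mf /eqP sf].
  rewrite !(@root_weight1E c _ n.+1) // /sh !coefB !coefZ !coefXn eqxx !mulr1 mulr0 subr0.
  by rewrite opprB psiD /= mulrA.
move/eqP; rewrite -subr_eq0 -{1}[msum _ _]mul1r -mulrBl mulf_eq0 subr_eq0.
by case/orP => /eqP // e; case: pb.
Qed.

(** The lifting theorem of Hasse and Davenport.  Since the monic sums of
degree > 1 vanish, the recurrence for them reads T_(r + 1) = - g T_r. *)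
Lemma orbit_sum_gauss c r : orbit_sum (root_weight 1 c) r.+1 = gauss c * (- gauss c) ^+ r.
Proof.
have rec n := monic_sum_recurrence iota (@root_weightM 1 c) n.
elim: r => [|r IH].
  by have := rec 1%N; rewrite big_nat1 monic_sum_weight0 monic_sum_weight1 mul1r !mulr1.
have := rec r.+2; rewrite monic_sum_weight_big // mulr0 => /esym.
rewrite big_nat_recr //= subnn monic_sum_weight0 mulr1 big_nat_recr //= subSnn.
rewrite monic_sum_weight1 big_nat big1 => [|j /andP[j0 jr]]; last first.
  by rewrite monic_sum_weight_big ?mulr0 // ltn_subRL addn1 ltnS.
by move/eqP; rewrite add0r IH addrC addr_eq0 => /eqP ->; rewrite exprSr; ring.
Qed.

Lemma orbit_sum_weight_gauss m r (l e : nat) : #|F|.-1 = (l * e)%N -> (0 < l)%N ->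
  orbit_sum (root_weight l (l%:Z * m)) r.+1 =
  \sum_(i < l) gauss (m + (i * e)%N%:Z) * (- gauss (m + (i * e)%N%:Z)) ^+ r.
Proof.
move=> qE l0; rewrite orbit_sum_weight_power // (sum_field_weight_power _ qE) //.
by apply: eq_bigr => i _; rewrite -orbit_sum_gauss orbit_sum_weight1.
Qed.

(** Both sides satisfy the same recurrence, of the form of Newton's
identities for the list of the l Gauss sums. *)
Lemma monic_sum_weight_elem m n (l e : nat) : #|F|.-1 = (l * e)%N -> (0 < l)%N ->
  msum (root_weight l (l%:Z * m)) n =
  (elem_poly [seq gauss (m + (i * e)%N%:Z) | i <- seq.iota 0 l])`_n.
Proof.
move=> qE l0; elim/ltn_ind: n => -[_|n IH]; first by rewrite monic_sum_weight0 elem_poly0.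
have n0 : n.+1%:R != 0 :> C by rewrite pnatr_eq0.
apply: (mulfI n0); rewrite newton_recurrence (monic_sum_recurrence iota) //; last first.
  exact: root_weightM.
rewrite big_add1 /= big_mkord; apply: eq_bigr => i _; rewrite subSS IH; last first.
  by rewrite ltnS leq_subr.
congr (_ * _); rewrite (orbit_sum_weight_gauss _ _ qE) // big_map.
by rewrite -(big_mkord xpredT (fun j => gauss (m + (j * e)%N%:Z) *
  (- gauss (m + (j * e)%N%:Z)) ^+ i)) /index_iota subn0.
Qed.

Lemma elem_poly_conj_roots f n j : f \is monic -> size f = n.+1 -> (j <= n)%N ->
  (elem_poly (map -%R (conj_roots f)))`_j = iota f`_(n - j).
Proof.
move=> mf sf jn; have szr : size (conj_roots f) = n.
  by apply/succn_inj; rewrite -size_conj_roots.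
rewrite elem_poly_rev size_map szr // -coef_map conj_rootsE // big_map.
by under eq_bigr do rewrite polyCN.
Qed.

Lemma power_sum_conj_roots g a k : g \is monic -> size g = k.+1 ->
  power_sum (conj_roots ('X * g + a%:P)) k.+1 =
  power_sum (conj_roots ('X * g)) k.+1 - k.+1%:R * iota a.
Proof.
move=> mg sg; have gM : g \in monics k by rewrite mem_monics mg sg eqxx.
have monP b : ('X * g + b%:P \is monic) && (size ('X * g + b%:P) == k.+2).
  by rewrite -mem_monics; apply: allpairs_f; rewrite ?mem_enum.
have /andP[mf /eqP sf] := monP a.
have /andP[m0 /eqP s0] := monP 0; rewrite addr0 in m0 s0.
have := @power_sum_change_last _ (conj_roots ('X * g + a%:P)) (conj_roots ('X * g)) k.
rewrite !(elem_poly_conj_roots _ (n := k.+1)) // subnn coefD !coefXM coefC /= add0r.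
rewrite rmorph0 mulr0 addr0 => <- => [|j jk]; first by rewrite addrK.
rewrite !(elem_poly_conj_roots _ (n := k.+1)) ?(leqW jk) // subSn //.
by rewrite coefD coefC /= addr0.
Qed.

(** Every monic polynomial of degree l is X g + a.  The l-th power sum of its
roots is - l a plus a term depending on g alone, and the product of its roots is
(-1)^l a, so for fixed g the sum over a is a Gauss sum in u = - l a. *)
Lemma monic_sum_weight_last k : k.+1%:R != 0 :> F -> exists K0 : C, forall m : int,
  msum (root_weight k.+1 (k.+1%:Z * m)) k.+1 =
  K0 * chi k.+1%:R ^ (- (k.+1%:Z * m)) * gauss (k.+1%:Z * m).
Proof.
move=> l0; set l := k.+1 in l0 *.
exists (\sum_(g <- monics k) psi (descend (power_sum (conj_roots ('X * g)) l))) => m.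
rewrite /monic_sum big_allpairs_dep -mulrA big_distrl /= big_seq [RHS]big_seq.
apply: eq_bigr => g gM; have := gM; rewrite mem_monics => /andP[mg /eqP sg].
have monP b : ('X * g + b%:P \is monic) && (size ('X * g + b%:P) == l.+1).
  by rewrite -mem_monics; apply: allpairs_f; rewrite ?mem_enum.
have /andP[m0 /eqP s0] := monP 0; rewrite addr0 in m0 s0.
rewrite big_enum /= /gauss !big_distrr /= [RHS]big_mkcond /=.
rewrite [RHS](reindex_inj (mulfI l0)) [RHS](reindex_inj oppr_inj) /=.
apply: eq_bigr => a _; have /andP[ma /eqP sa] := monP a.
rewrite /root_weight (descend_prod_conj_roots ma sa) power_sum_conj_roots //.
have -> : descend (power_sum (conj_roots ('X * g)) l - l%:R * iota a) =
          descend (power_sum (conj_roots ('X * g)) l) + l%:R * - a.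
  have -> : - (l%:R * iota a) = iota (l%:R * - a) by rewrite rmorphM rmorphN rmorph_nat mulrN.
  by rewrite descendD ?frob_power_sum ?frob_rmorph // rmorph_descend.
have -> : ('X * g + a%:P)`_0 = a by rewrite coefD coefXM coefC add0r.
rewrite psiD.
(* The sign disappears in l-th powers: ((-1)^l)^l = (-1)^l. *)
have -> : chi0 (l%:Z * m) ((-1) ^+ l * a) = chi0 (l%:Z * m) (l%:R^-1 * (l%:R * - a)).
  rewrite mulKf // -!chi0X // [X in chi0 _ X]exprMn [X in _ = chi0 _ X]exprNn.
  congr (chi0 _ (_ * _)); rewrite -exprM -[LHS]signr_odd oddM andbb.
  exact: signr_odd.
rewrite chi0M {1}/chi0 invr_eq0 (negPf l0) chiV // -exprz_inv.
by rewrite /chi0; case: eqVneq => _ /=; rewrite ?mulr0 //; ring.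
Qed.

Lemma hasse_davenport_ext k e : #|F|.-1 = (k.+1 * e)%N -> exists K0 : C, forall m : int,
  \prod_(i < k.+1) gauss (m + (i * e)%N%:Z) =
  K0 * chi k.+1%:R ^ (- (k.+1%:Z * m)) * gauss (k.+1%:Z * m).
Proof.
move=> qE; have l0 : k.+1%:R != 0 :> F by rewrite natr_predq_neq0 // qE dvdn_mulr.
have [K0 K0E] := monic_sum_weight_last l0; exists K0 => m.
rewrite -K0E (monic_sum_weight_elem _ _ qE) //.
set s := [seq _ | i <- _]; have szs : size s = k.+1 by rewrite size_map size_iota.
rewrite -[in RHS]szs elem_poly_size big_map.
by rewrite -(big_mkord xpredT (fun i => gauss (m + (i * e)%N%:Z))) /index_iota subn0.
Qed.
End Extension.

(** The constant K0 does not depend on m.  It could be made explicit by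
setting m = 0, but only quotients of two instances are used. *)
Theorem hasse_davenport_product l e : #|F|.-1 = (l * e)%N -> exists K0 : C, forall m : int,
  \prod_(i < l) gauss (m + (i * e)%N%:Z) =
  K0 * chi l%:R ^ (- (l%:Z * m)) * gauss (l%:Z * m).
Proof.
case: l => [|k] qE; first by have := finNzRing_gt1 F; rewrite -ltn_predRL qE.
have [K [iota _]] := countable_algebraic_closure F.
exact: (hasse_davenport_ext iota qE).
Qed.

Local Notation Q := (#|F|.-1).

Lemma predq_gt0 : (0 < Q)%N.
Proof. by rewrite -ltnS prednK ?card_finField_gt0 ?finNzRing_gt1. Qed.

Lemma expf_predq x : x != 0 -> x ^+ Q = 1 :> F.
Proof.
move=> x0; apply: (mulfI x0).
by rewrite -exprS prednK ?card_finField_gt0 // expf_card mulr1.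
Qed.

Lemma exists_primitive_element : exists w : F, Q.-primitive_root w.
Proof.
pose s := [seq x <- enum F | x != 0].
have /hasP[w _ pw] : has Q.-primitive_root s; last by exists w.
apply: has_prim_root; rewrite ?predq_gt0 ?filter_uniq -?enumT ?enum_uniq //.
  by apply/allP => x; rewrite mem_filter unity_rootE => /andP[/expf_predq -> _].
rewrite /s size_filter -sum1_count big_enum_cond /= sum1_card.
by rewrite (cardC1 0) -ltnS prednK ?card_finField_gt0.
Qed.

Lemma chi_expz_predq u (k : int) : u != 0 -> chi u ^ (Q%:Z * k) = 1.
Proof. by move=> u0; rewrite -exprz_exp -exprnP -chiX // expf_predq // chi1 exp1rz. Qed.

Lemma chi_expz_congr u (a b : int) : u != 0 -> (Q %| a - b)%Z -> chi u ^ a = chi u ^ b.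
Proof.
move=> u0 /dvdzP[k abE]; rewrite -(subrK b a) abE expfzDr ?chi_neq0 //.
by rewrite [k * _]mulrC chi_expz_predq ?mul1r.
Qed.

Lemma gauss_congr a b : (Q %| a - b)%Z -> gauss a = gauss b.
Proof.
by move=> ab; apply: eq_bigr => u u0; rewrite (chi_expz_congr u0 ab).
Qed.

Lemma sum_psi_units : \sum_(u : F | u != 0) psi u = -1.
Proof.
by apply/eqP; have := sum_psi; rewrite (bigD1 0) //= psi0 addrC => /eqP; rewrite addr_eq0.
Qed.

Lemma gauss_trivial a : (Q %| a)%Z -> gauss a = -1.
Proof.
rewrite -[a in (_ %| a)%Z]subr0 => /gauss_congr ->; rewrite -sum_psi_units.
by apply: eq_bigr => u _; rewrite expr0z mulr1.
Qed.

Lemma sum_chi c : ~~ (Q %| c)%Z -> \sum_(u : F | u != 0) chi u ^ c = 0.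
Proof.
move=> nQc; have [w pw] := exists_primitive_element.
have w0 : w != 0.
  by apply/eqP => e; have := prim_expr_order pw; rewrite e expr0n gtn_eqF ?predq_gt0 // =>
    /esym/eqP; rewrite oner_eq0.
have chiw : chi w ^ c != 1.
  apply: contra nQc => /eqP wc; rewrite dvdzE /= (prim_order_dvd pw).
  apply/eqP/chi_inj; rewrite ?expf_neq0 // chiX //.
  case: c wc => n /=; first by [].
  by rewrite NegzE -exprnN => /eqP; rewrite invr_eq1 => /eqP.
have : \sum_(u : F | u != 0) chi u ^ c = chi w ^ c * \sum_(u : F | u != 0) chi u ^ c.
  rewrite [LHS](reindex_inj (mulfI w0)) /= big_distrr /=.
  apply: eq_big => [u|u]; rewrite mulf_eq0 negb_or w0 //= => u0.
  by rewrite chiM // expfzMl.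
move/eqP; rewrite -subr_eq0 -{1}[\sum_(u | _) _]mul1r -mulrBl mulf_eq0 subr_eq0.
by rewrite eq_sym (negPf chiw) /= => /eqP.
Qed.

(** Expand the product of the two sums and substitute u = v w: the inner sum
over v of psi (v (w + 1)) is -1 unless w = -1.  In the trivial case both Gauss
sums are -1. *)
Lemma gauss_reflection c : gauss c * gauss (- c) =
  chi (-1) ^ c * if (Q %| c)%Z then 1 else #|F|%:R.
Proof.
have m1 : (-1 : F) != 0 by rewrite oppr_eq0 oner_eq0.
case: ifPn => Qc.
  rewrite !gauss_trivial ?rpredN // mulrNN !mulr1.
  by rewrite (@chi_expz_congr _ _ 0) ?subr0 // expr0z.
have -> : gauss c * gauss (- c) =
    \sum_(w : F | w != 0) chi w ^ c * \sum_(v : F | v != 0) psi (v * (w + 1)).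
  transitivity (\sum_(v : F | v != 0) \sum_(w : F | w != 0) chi w ^ c * psi (v * (w + 1))).
    rewrite /gauss mulrC big_distrl /=; apply: eq_bigr => v v0.
    rewrite big_distrr /= (reindex_inj (mulfI v0)) /=.
    apply: eq_big => [w|w]; rewrite mulf_eq0 negb_or v0 //= => w0.
    rewrite chiM // expfzMl mulrDr mulr1 psiD -invr_expz.
    have := expfz_neq0 c (chi_neq0 v0); move: (chi v ^ c) (chi w ^ c) => x y x0.
    by field.
  by rewrite exchange_big /=; apply: eq_bigr => w w0; rewrite big_distrr.
rewrite (bigD1 (-1)) //= addrC.
have -> : \sum_(w : F | (w != 0) && (w != -1)) chi w ^ c *
      \sum_(v | v != 0) psi (v * (w + 1)) =
    - \sum_(w : F | (w != 0) && (w != -1)) chi w ^ c.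
  rewrite -sumrN; apply: eq_bigr => w /andP[w0 w1].
  have w10 : w + 1 != 0 by rewrite addr_eq0.
  rewrite -[RHS]mulrN1 -sum_psi_units; congr (_ * _).
  rewrite [RHS](reindex_inj (mulIf w10)) /=; apply: eq_bigl => v.
  by rewrite mulf_eq0 negb_or w10 andbT.
have := sum_chi Qc; rewrite (bigD1 (-1)) //= addrC => /eqP; rewrite addr_eq0 => /eqP ->.
under eq_bigr do rewrite addrC subrr mulr0 psi0.
rewrite sumr_const (cardC1 0) opprK -[X in X + _ = _]mulr1 -mulrDr; congr (_ * _).
by rewrite addrC natr1 prednK ?card_finField_gt0.
Qed.

Lemma natr_card_neq0 : #|F|%:R != 0 :> C.
Proof. by rewrite pnatr_eq0 -lt0n card_finField_gt0. Qed.

Lemma gauss_neq0 c : gauss c != 0.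
Proof.
have := gauss_reflection c.
apply: contra_eq_neq => ->; rewrite mul0r eq_sym mulf_neq0 //.
  by rewrite expfz_neq0 // chi_neq0 // oppr_eq0 oner_eq0.
by case: ifP; rewrite ?oner_eq0 ?natr_card_neq0.
Qed.

Lemma gauss_ratio_neg b c : gauss (- b) / gauss (- c) =
  chi (-1) ^ (b - c) * #|F|%:R ^ ((Q %| c)%Z%:Z - (Q %| b)%Z%:Z) * (gauss c / gauss b).
Proof.
have m0 : chi (-1) != 0 by rewrite chi_neq0 // oppr_eq0 oner_eq0.
have q0 := natr_card_neq0.
have negE a : gauss (- a) = chi (-1) ^ a * (#|F|%:R * #|F|%:R ^ (- (Q %| a)%Z%:Z)) / gauss a.
  apply: (mulfI (gauss_neq0 a)); rewrite gauss_reflection //.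
  rewrite [RHS]mulrCA mulfV ?gauss_neq0 // mulr1; congr (_ * _).
  by case: ifP; rewrite ?oppr0 ?expr0z ?mulr1 // -invr_expz expr1z mulfV.
rewrite !negE !expfzDr // -!invr_expz.
have ? := gauss_neq0 b; have ? := gauss_neq0 c.
have ? := expfz_neq0 c m0; have ? := expfz_neq0 b m0.
have ? := expfz_neq0 (Q %| c)%Z%:Z q0; have ? := expfz_neq0 (Q %| b)%Z%:Z q0.
by field; do ?[apply/andP; split].
Qed.

(** The number attached to the factor X^k - exp(2 pi i c / Q).  It is
normalised to be 1 at m = 0, and the power of chi absorbs the one that occurs in
the product formula. *)
Definition gauss_ratio (m : int) (kc : nat * int) : C :=
  gauss (kc.1%:Z * m + kc.2) / gauss kc.2 * chi kc.1%:R ^ (- (kc.1%:Z * m)).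

Lemma gauss_ratio_congr m k c c' : (Q %| c - c')%Z ->
  gauss_ratio m (k, c) = gauss_ratio m (k, c').
Proof.
move=> cc'; rewrite /gauss_ratio /=; congr (_ / _ * _); apply: gauss_congr => //.
by rewrite opprD addrACA subrr add0r.
Qed.

(** The product formula, used at k m + c and at c: the unknown constant
cancels in the quotient. *)
Lemma gauss_ratio_split m k l e c : coprime #|F| (k * l) -> Q = (l * e)%N ->
  gauss_ratio m ((k * l)%N, c * l%:Z) = \prod_(i < l) gauss_ratio m (k, c + (i * e)%N%:Z).
Proof.
rewrite coprimeMr => /andP[/natr_coprime_neq0 k0 /natr_coprime_neq0 l0] QE.
have [K0 K0E] := hasse_davenport_product QE.
have K0n0 : K0 != 0.
  have : \prod_(i < l) gauss (0 + (i * e)%N%:Z) != 0.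
    by apply/prodf_neq0 => i _; apply: gauss_neq0.
  by rewrite K0E; apply: contraNneq => ->; rewrite !mul0r.
rewrite /gauss_ratio /= big_split /= big_split /= prodfV K0E.
under eq_bigr do rewrite addrA.
rewrite K0E prodr_const card_ord.
have ck := chi_neq0 k0; have cl := chi_neq0 l0.
rewrite natrM chiM // expfzMl exprnP exprz_exp.
have -> : (k * l)%N%:Z * m + c * l%:Z = l%:Z * (k%:Z * m + c) by rewrite PoszM; ring.
have -> : c * l%:Z = l%:Z * c by rewrite mulrC.
have -> : - (k%:Z * m) * l%:Z = - ((k * l)%N%:Z * m) by rewrite PoszM; ring.
have -> : - ((k * l)%N%:Z * m) = - (l%:Z * (k%:Z * m + c)) + l%:Z * c.
  by rewrite PoszM; ring.
rewrite [chi l%:R ^ (_ + _)]expfzDr // -[chi l%:R ^ (- (l%:Z * c))]invr_expz.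
have ? := gauss_neq0 (l%:Z * c); have ? := expfz_neq0 (l%:Z * c) cl.
by field; do ?[apply/andP; split].
Qed.

Lemma gauss_ratio_neq0 m kc : kc.1%:R != 0 :> F -> gauss_ratio m kc != 0.
Proof.
move=> k0; rewrite /gauss_ratio !mulf_neq0 ?invr_eq0 ?gauss_neq0 //.
by rewrite expfz_neq0 // chi_neq0.
Qed.

(** For a < 0 the definition applies as it stands.  For a > 0 the arguments
are negative, and reflection inverts the ratio and produces a power of q; the
sign chi (-1) comes from a = - |a| in the first case, from reflection in the
second. *)
Lemma gamma_term (m a c : int) : a != 0 -> coprime #|F| `|a| ->
  gauss (- a * m + c) / gauss c * chi a%:~R ^ (a * m) =
  chi (-1) ^ (a * m) *
  (if a < 0 then gauss_ratio m (`|a|%N, c)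
   else (gauss_ratio m (`|a|%N, - c))^-1 *
        #|F|%:R ^ ((Q %| c)%Z%:Z - (Q %| - a * m + c)%Z%:Z)).
Proof.
move=> a0 /natr_coprime_neq0; move: a0; case: (intP a) => [//|k|k] _ k0.
  have -> : (k.+1%:Z < 0) = false by [].
  have ck := chi_neq0 k0; rewrite !absz_nat.
  have := gauss_ratio_neg (k.+1%:Z * m - c) (- c).
  have -> : - (k.+1%:Z * m - c) = - k.+1%:Z * m + c by ring.
  have -> : (Q %| - k.+1%:Z * m + c)%Z = (Q %| k.+1%:Z * m - c)%Z.
    by rewrite -(rpredN _ (k.+1%:Z * m - c)); congr (_ %| _)%Z; ring.
  rewrite opprK rpredN => ->; rewrite subrK /gauss_ratio /=.
  rewrite -pmulrn -[chi _ ^ (- _)]invr_expz.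
  have ? := gauss_neq0 (k.+1%:Z * m - c).
  have ? := gauss_neq0 (- c).
  have ? := expfz_neq0 (k.+1%:Z * m) ck.
  by field; do ?[apply/andP; split].
have -> : (- k.+1%:Z < 0) = true by [].
rewrite abszN absz_nat in k0 *.
have ck := chi_neq0 k0.
have m1 : (-1 : F) != 0 by rewrite oppr_eq0 oner_eq0.
have -> : (- k.+1%:Z)%:~R = -1 * k.+1%:R :> F by rewrite intrN -pmulrn mulN1r.
rewrite chiM // expfzMl /gauss_ratio /= opprK mulNr.
by ring.
Qed.

Lemma params_term (m a b : int) :
  (gauss (m + a) * gauss (- m - b)) / (gauss a * gauss (- b)) =
  chi (-1) ^ m * (gauss_ratio m (1%N, a) * (gauss_ratio m (1%N, b))^-1 *
    #|F|%:R ^ ((Q %| b)%Z%:Z - (Q %| m + b)%Z%:Z)).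
Proof.
have := gauss_ratio_neg (m + b) b.
rewrite addrK opprD => e; rewrite -mulf_div e /gauss_ratio /= chi1 exp1rz !mul1r !mulr1.
have ? := gauss_neq0 (m + b).
have ? := gauss_neq0 b.
have ? := gauss_neq0 a.
by field; do ?[apply/andP; split].
Qed.

Lemma chi_prod (I : Type) (r : seq I) (P : pred I) (x : I -> F) :
  (forall i, P i -> x i != 0) ->
  chi (\prod_(i <- r | P i) x i) = \prod_(i <- r | P i) chi (x i).
Proof.
move=> x0; suff [] : chi (\prod_(i <- r | P i) x i) = \prod_(i <- r | P i) chi (x i) /\
    \prod_(i <- r | P i) x i != 0 by [].
elim: r => [|i r [IH n0]]; first by rewrite !big_nil chi1 oner_eq0.
rewrite !big_cons; case: ifP => // Pi.
by rewrite chiM ?x0 // IH mulf_neq0 ?x0.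
Qed.

Lemma chi_expz x (n : int) : x != 0 -> chi (x ^ n) = chi x ^ n.
Proof.
move=> x0; case: n => n; first by rewrite -!exprnP chiX.
by rewrite NegzE -!exprnN chiV ?expf_neq0 // chiX.
Qed.

(** The signs chi (-1) ^ (gam j * m) cancel because the gam j sum to zero. *)
Lemma gamma_product d (gam c : 'I_d -> int) (m : int) (t : F) : t != 0 ->
  (forall j, gam j != 0) -> \sum_j gam j = 0 -> (forall j, coprime #|F| `|gam j|) ->
  \prod_j (gauss (- gam j * m + c j) / gauss (c j)) *
    chi (\prod_j ((gam j)%:~R ^ gam j) * t) ^ m =
  (\prod_(j | gam j < 0) gauss_ratio m (`|gam j|%N, c j)) /
  (\prod_(j | 0 < gam j) gauss_ratio m (`|gam j|%N, - c j)) *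
  #|F|%:R ^ (\sum_(j | 0 < gam j)
     ((Q %| c j)%Z%:Z - (Q %| - gam j * m + c j)%Z%:Z)) * chi t ^ m.
Proof.
move=> t0 gam0 sum0 copr.
have gamF j : (gam j)%:~R != 0 :> F.
  have := natr_coprime_neq0 (copr j); case: (gam j) => k //=.
  by rewrite NegzE intrN oppr_eq0.
have prodF : \prod_j ((gam j)%:~R ^ gam j) != 0 :> F.
  by apply/prodf_neq0 => j _; rewrite expfz_neq0.
rewrite chiM // expfzMl mulrA; congr (_ * _).
rewrite chi_prod => [|j _]; last by rewrite expfz_neq0.
rewrite -[LHS]mulr1 -mulrA.
have m1 : chi (-1) != 0 by rewrite chi_neq0 // oppr_eq0 oner_eq0.
have -> : (\prod_j chi ((gam j)%:~R ^ gam j)) ^ m =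
    \prod_j chi (gam j)%:~R ^ (gam j * m).
  rewrite (big_morph (fun z => z ^ m) (id1 := 1) (op1 := *%R)) ?exp1rz //; last first.
    by move=> x y; rewrite expfzMl.
  by apply: eq_bigr => j _; rewrite chi_expz // exprz_exp.
rewrite mulr1 -big_split /=.
under eq_bigr do rewrite gamma_term //.
rewrite big_split /= prod_expz // -mulr_suml sum0 mul0r expr0z mul1r.
rewrite (bigID (fun j => gam j < 0)) /= -mulrA; congr (_ * _).
  by apply: eq_bigr => j ->.
have pos j : ~~ (gam j < 0) = (0 < gam j).
  by rewrite -leNgt le_eqVlt eq_sym (negPf (gam0 j)).
under eq_bigl do rewrite pos.
rewrite -prodfV -prod_expz ?natr_card_neq0 // -big_split /=.
by apply: eq_bigr => j pj; rewrite ltNge (ltW pj).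
Qed.

(** The sign chi (-1) ^ m produced by each reflection cancels against the
factor (-1)^n in the argument. *)
Lemma params_product n (a b : 'I_n -> int) (m : int) (t : F) : t != 0 ->
  \prod_i ((gauss (m + a i) * gauss (- m - b i)) / (gauss (a i) * gauss (- b i))) *
    chi ((-1) ^+ n * t) ^ m =
  (\prod_i gauss_ratio m (1%N, a i)) / (\prod_i gauss_ratio m (1%N, b i)) *
  #|F|%:R ^ (\sum_i ((Q %| b i)%Z%:Z - (Q %| m + b i)%Z%:Z)) * chi t ^ m.
Proof.
move=> t0; have m1 : (-1 : F) != 0 by rewrite oppr_eq0 oner_eq0.
rewrite chiM ?expf_neq0 // expfzMl mulrA; congr (_ * _).
under eq_bigr do rewrite params_term.
rewrite big_split /= prodr_const card_ord mulrC mulrA.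
have -> : chi ((-1) ^+ n) ^ m * (chi (-1) ^ m) ^+ n = 1.
  have sq1 : chi (-1) * chi (-1) = 1 by rewrite -chiM // mulrNN mulr1.
  rewrite chiX // exprnP exprzAC -exprnP -expfzMl -exprMn sq1.
  by rewrite expr1n exp1rz.
by rewrite mul1r -[in RHS]prod_expz ?natr_card_neq0 // -prodfV -!big_split.
Qed.
End CharacterSums.

Local Open Scope complex_scope.

(** * The exponential of a rational number *)

Section RootsOfUnity.
Variable R : realType.
Local Notation e := (e2pii R).

Lemma e2piiD x y : e (x + y) = e x * e y.
Proof.
rewrite /e2pii rmorphD mulrDr cosD sinD; set a := _ * ratr x; set b := _ * ratr y.
by apply/eqP; rewrite eq_complex /= eqxx /= addrC eqxx.
Qed.

Lemma e2pii0 : e 0 = 1.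
Proof. by rewrite /e2pii rmorph0 mulr0 cos0 sin0. Qed.

Lemma e2pii1 : e 1 = 1.
Proof. by rewrite /e2pii rmorph1 mulr1 mulr_natl cos2pi sin2pi. Qed.

Lemma e2pii_neq0 x : e x != 0.
Proof.
apply/eqP => ex; have := e2piiD x (- x).
by rewrite subrr e2pii0 ex mul0r => /eqP; rewrite oner_eq0.
Qed.

Lemma e2piiN x : e (- x) = (e x)^-1.
Proof. by apply: (mulfI (e2pii_neq0 x)); rewrite -e2piiD subrr e2pii0 mulfV ?e2pii_neq0. Qed.

Lemma e2piiMn x n : e (x *+ n) = e x ^+ n.
Proof. by elim: n => [|n IH]; rewrite ?mulr0n ?e2pii0 // mulrS e2piiD IH exprS. Qed.

Lemma e2piiMz x (n : int) : e (x * n%:~R) = e x ^ n.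
Proof.
case: n => n; first by rewrite -pmulrn mulr_natr e2piiMn.
by rewrite NegzE mulrNz mulrN -pmulrn mulr_natr e2piiN e2piiMn exprnN.
Qed.

Lemma e2pii_int x : x \is a Num.int -> e x = 1.
Proof. by move=> /intrP[n ->]; rewrite -[_%:~R]mul1r e2piiMz e2pii1 exp1rz. Qed.

(** For 0 < x < 1/2 the sine is positive, for 1/2 < x < 1 it is negative, and
at 1/2 the cosine is -1. *)
Lemma e2pii_eq1_lt1 x : 0 <= x < 1 -> e x = 1 -> x = 0.
Proof.
move=> /andP[x0 x1] ex.
have [//|xn0] := eqVneq x 0.
have {xn0} x0' : 0 < x by rewrite lt_def xn0.
move: ex; rewrite /e2pii; set y := ratr x : R => -[c1 s0].
have y0 : 0 < y by rewrite ltr0q.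
have y1 : y < 1 by rewrite -(ltr_rat R) rmorph1 in x1.
have pi0 := pi_gt0 R.
have [yh|yh|yh] := ltgtP y (1/2).
- have a0 : 0 < pi * (1 - 2 * y) by apply: mulr_gt0 => //; lra.
  have b0 : 0 < pi * y by apply: mulr_gt0.
  have : 0 < sin (2 * pi * y) by apply: sin_gt0_pi; lra.
  by rewrite s0 ltxx.
- have a0 : 0 < pi * (2 * y - 1) by apply: mulr_gt0 => //; lra.
  have b0 : 0 < pi * (1 - y) by apply: mulr_gt0 => //; lra.
  have : 0 < sin (2 * pi * y - pi) by apply: sin_gt0_pi; lra.
  by rewrite sinB sinpi cospi s0 mul0r mulr0 subrr ltxx.
- have : cos (2 * pi * y) = -1.
    by rewrite (_ : 2 * pi * y = pi) ?cospi // yh; field.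
  rewrite c1 => h; have : (0 : R) < 0 by lra.
  by rewrite ltxx.
Qed.

Lemma e2pii_eq1 x : (e x == 1) = (x \is a Num.int).
Proof.
apply/eqP/idP => [ex|/e2pii_int //].
have : e (x - (Num.floor x)%:~R) = 1.
  by rewrite e2piiD ex mul1r e2pii_int // rpredN intr_int.
have fx : x - (Num.floor x)%:~R < 1 by rewrite ltrBlDl -[1 in ltRHS]/(1%:~R) -intrD lt_succ_floor.
move/e2pii_eq1_lt1; rewrite subr_ge0 ge_floor fx => /(_ isT)/eqP.
by rewrite subr_eq0 => /eqP ->; rewrite intr_int.
Qed.

Lemma e2pii_eq x y : (e x == e y) = (x - y \is a Num.int).
Proof.
rewrite -e2pii_eq1 e2piiD e2piiN.
by rewrite -[in RHS](inj_eq (mulIf (e2pii_neq0 y))) mulfVK ?e2pii_neq0 // mul1r.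
Qed.

End RootsOfUnity.

(** * Multiplicative relations between Kummer polynomials *)

Lemma intr_div_int (a : int) (n : nat) : (0 < n)%N ->
  (a%:~R / n%:R \is a @Num.int rat) = (n %| a)%Z.
Proof.
move=> n0; have nn : n%:R != 0 :> rat by rewrite pnatr_eq0 -lt0n.
apply/intrP/dvdzP => -[k kE]; exists k; last by rewrite kE intrM mulfK.
by apply: (@intr_inj rat); rewrite intrM -kE mulfVK.
Qed.

Lemma e2pii_frac_eq (R : realType) (a b : int) (n : nat) : (0 < n)%N ->
  (e2pii R (a%:~R / n%:R) == e2pii R (b%:~R / n%:R)) = (n %| a - b)%Z.
Proof. by move=> n0; rewrite e2pii_eq -mulrBl -intrB intr_div_int. Qed.

(** Take for i the product of the primes l dividing k but not c.  A prime
divisor of k that divides c does not divide i Q, and one that does not divide c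
divides i. *)
Lemma exists_coprime_progression (k Q : nat) (c : int) : (0 < k)%N ->
  (forall l, prime l -> (l %| k)%N -> (l %| Q)%N -> ~~ (l %| c)%Z) ->
  exists i : nat, coprimez k (c + i%:Z * Q%:Z).
Proof.
move=> k0 red; exists (\prod_(l <- primes k | ~~ (l %| c)%Z) l)%N.
set i := (\prod_(_ <- _ | _) _)%N; rewrite coprimezE absz_nat.
apply/negPn/negP; rewrite /coprime => ng1.
set g := gcdn _ _ in ng1; have g0 : (0 < g)%N by rewrite gcdn_gt0 k0.
have lp : prime (pdiv g) by apply: pdiv_prime; rewrite ltn_neqAle eq_sym ng1.
have lg := pdiv_dvd g; move: lp lg; set l := pdiv g => lp lg.
have lk : (l %| k)%N := dvdn_trans lg (dvdn_gcdl _ _).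
have lc : (l %| c + i%:Z * Q%:Z)%Z by rewrite dvdzE; apply: dvdn_trans lg (dvdn_gcdr _ _).
have [dc|ndc] := boolP (l %| c)%Z.
  move: lc; rewrite rpredDl // -PoszM dvdzE /= Euclid_dvdM // => /orP[|lQ]; last first.
    by have := red l lp lk lQ; rewrite dc.
  rewrite /i; elim: (primes k) (all_prime_primes k) => [|p s IH] /=.
    by rewrite big_nil dvdn1 => _ /eqP l1; rewrite l1 in lp.
  move=> /andP[pp ps]; rewrite big_cons; case: ifP => [np|_]; last exact: IH.
  rewrite Euclid_dvdM // => /orP[|]; last exact: IH.
  by rewrite dvdn_prime2 // => /eqP lpE; rewrite -lpE dc in np.
have li : (l %| i)%N.
  rewrite /i -big_filter (bigD1_seq l) ?filter_uniq ?primes_uniq //= ?dvdn_mulr //.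
  by rewrite mem_filter ndc mem_primes lp k0 lk.
by move: lc; rewrite rpredDr ?(negPf ndc) // -PoszM dvdzE /= dvdn_mulr.
Qed.

Section CyclotomicRelations.
Variables (R : realType) (Q : nat).
Hypothesis Q_gt0 : (0 < Q)%N.

(** Exponents c are kept in units of 1 / Q, so that only residues modulo Q
matter. *)
Definition kummer_poly (kc : nat * int) : {poly R[i]} :=
  'X^(kc.1) - (e2pii R (kc.2%:~R / Q%:R))%:P.

Lemma kummer_poly_monic kc : (0 < kc.1)%N -> kummer_poly kc \is monic.
Proof. by move=> k0; apply: monicXnsubC. Qed.

Lemma kummer_poly_congr k c c' : (Q %| c - c')%Z -> kummer_poly (k, c) = kummer_poly (k, c').
Proof. by rewrite -(e2pii_frac_eq R) // /kummer_poly => /eqP ->. Qed.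

Lemma root_kummer_poly k c x :
  root (kummer_poly (k, c)) x = (x ^+ k == e2pii R (c%:~R / Q%:R)).
Proof. by rewrite /root /kummer_poly !hornerE subr_eq0. Qed.

Lemma Xn_sub_prod (l : nat) (z : R[i]) : (0 < l)%N -> z != 0 ->
  'X^l - (z ^+ l)%:P = \prod_(i < l) ('X - (z * e2pii R (i%:~R / l%:R))%:P).
Proof.
move=> l0 z0; pose rs := [seq z * e2pii R (i%:Z%:~R / l%:R) | i <- index_iota 0 l].
have -> : \prod_(i < l) ('X - (z * e2pii R (i%:~R / l%:R))%:P) =
    \prod_(y <- rs) ('X - y%:P).
  by rewrite big_map big_mkord.
have mon : 'X^l - (z ^+ l)%:P \is monic by apply: monicXnsubC.
have := @all_roots_prod_XsubC _ ('X^l - (z ^+ l)%:P) rs.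
rewrite (monicP mon) scale1r; apply.
- by rewrite size_XnsubC // size_map size_iota subn0.
- apply/allP => _ /mapP[i _ ->]; rewrite /root !hornerE exprMn -e2piiMn -[(_ / _) *+ _]mulr_natr.
  rewrite divfK ?pnatr_eq0 -?lt0n // e2pii_int ?intr_int //.
  by rewrite mulr1 subrr.
rewrite uniq_rootsE map_inj_in_uniq ?iota_uniq // => i j.
rewrite !mem_index_iota => /andP[_ il] /andP[_ jl] /(mulfI z0)/eqP.
rewrite e2pii_frac_eq // -eqz_mod_dvd !modz_small ?lez_nat ?ltz_nat //.
by move/eqP => [].
Qed.

Lemma kummer_poly_split k l e c : (0 < l)%N -> Q = (l * e)%N ->
  kummer_poly ((k * l)%N, c * l%:Z) = \prod_(i < l) kummer_poly (k, c + (i * e)%N%:Z).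
Proof.
move=> l0 QE; set z := e2pii R (c%:~R / Q%:R).
have Q0 : Q%:R != 0 :> rat by rewrite pnatr_eq0 -lt0n.
have l0' : l%:R != 0 :> rat by rewrite pnatr_eq0 -lt0n.
have -> : kummer_poly ((k * l)%N, c * l%:Z) = ('X^l - (z ^+ l)%:P) \Po 'X^k.
  rewrite comp_polyB comp_Xn_poly comp_polyC /kummer_poly /= exprM /z -e2piiMn.
  by rewrite -[(_ / _) *+ _]mulr_natr intrM mulrAC.
rewrite Xn_sub_prod ?e2pii_neq0 // rmorph_prod /=; apply: eq_bigr => i _.
rewrite comp_polyB comp_polyX comp_polyC /kummer_poly /= /z -e2piiD.
congr ('X^k - (e2pii R _)%:P); rewrite intrD mulrDl; congr (_ + _).
rewrite -!pmulrn natrM QE natrM; field.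
have e0 : e%:R != 0 :> rat by move: Q0; rewrite QE natrM mulf_eq0 negb_or => /andP[].
by rewrite ?l0' ?e0.
Qed.

(** The root is exp(2 pi i a / (k Q)) with a = c mod Q prime to k.  It is a
root of the polynomial of (k2, c2) iff k Q divides k2 a - k c2, and then k divides
k2 a, hence k2. *)
Lemma exists_primitive_root k c : (0 < k)%N ->
  (forall l, prime l -> (l %| k)%N -> (l %| Q)%N -> ~~ (l %| c)%Z) ->
  exists2 x, root (kummer_poly (k, c)) x &
    forall k2 c2, root (kummer_poly (k2, c2)) x ->
      (k %| k2)%N /\ (k2 = k -> (Q %| c - c2)%Z).
Proof.
move=> k0 red; have [i cop] := exists_coprime_progression k0 red.
set a := c + i%:Z * Q%:Z in cop; have kQ0 : (0 < k * Q)%N by rewrite muln_gt0 k0.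
have rootE k2 c2 : root (kummer_poly (k2, c2)) (e2pii R (a%:~R / (k * Q)%N%:R)) =
    ((k * Q)%N%:Z %| k2%:Z * a - k%:Z * c2)%Z.
  rewrite root_kummer_poly -e2piiMn -(e2pii_frac_eq R) //; congr (_ == e2pii R _).
    by congr (e2pii R _); rewrite -[_ *+ _]mulr_natr mulrAC intrM [X in X / _ = _]mulrC.
  rewrite intrM natrM -pmulrn; field.
  by rewrite !pnatr_eq0 -!lt0n k0 Q_gt0.
exists (e2pii R (a%:~R / (k * Q)%N%:R)) => [|k2 c2]; rewrite rootE.
  by rewrite -mulrBr /a addrC addKr PoszM mulrCA dvdz_mull.
move=> D; split=> [|e].
  have : (k%:Z %| k2%:Z * a - k%:Z * c2)%Z.
    by apply: dvdz_trans D; rewrite PoszM dvdz_mulr.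
  by rewrite rpredBr; [rewrite Gauss_dvdzl | apply: dvdz_mulr].
move: D; rewrite e -mulrBr PoszM dvdz_mul2l ?lt0n_neq0 // /a.
by rewrite addrAC rpredDr // dvdz_mull.
Qed.

Variables (M : comPzRingType) (P : pred nat) (Phi : nat * int -> M).
Hypothesis P_gt0 : forall k, P k -> (0 < k)%N.
Hypothesis P_dvd : forall k l, P (k * l)%N -> P k.
Hypothesis Phi_congr : forall k c c', (Q %| c - c')%Z -> Phi (k, c) = Phi (k, c').
Hypothesis Phi_split : forall k l e c, P (k * l)%N -> Q = (l * e)%N ->
  Phi ((k * l)%N, c * l%:Z) = \prod_(i < l) Phi (k, c + (i * e)%N%:Z).

Local Notation adm := (fun kc : nat * int => P kc.1).
(** Splitting a pair (k l, c l) into l pairs with first component k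
preserves the sum of the first components and lowers the sum of their squares. *)
Definition pair_weight (s : seq (nat * int)) := (\sum_(kc <- s) kc.1 ^ 2)%N.

(** The pairs to which an elementary relation applies. *)
Definition reducible (kc : nat * int) :=
  has (fun l => (l %| Q)%N && (l %| kc.2)%Z) (primes kc.1).

Lemma split_reducible s : all adm s -> has reducible s -> exists s',
  [/\ all adm s', (pair_weight s' < pair_weight s)%N,
      \prod_(kc <- s') kummer_poly kc = \prod_(kc <- s) kummer_poly kc
    & \prod_(kc <- s') Phi kc = \prod_(kc <- s) Phi kc].
Proof.
move=> Ps /hasP[[k c] ks /hasP[l]]; rewrite mem_primes => /and3P[lp k0 /dvdnP[k' kE]].
move=> /andP[/dvdnP[e QE] /dvdzP[c' cE]]; rewrite /= in k0 kE cE.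
have pe := perm_to_rem ks; have QE' : Q = (l * e)%N by rewrite QE mulnC.
have l0 := prime_gt0 lp.
have Pk : P (k' * l)%N by rewrite -kE; exact: (allP Ps (k, c) ks).
exists ([seq (k', c' + (i * e)%N%:Z) | i <- index_iota 0 l] ++ rem (k, c) s); split.
- rewrite all_cat; apply/andP; split.
    by apply/allP => _ /mapP[i _ ->] /=; apply: P_dvd Pk.
  by apply/allP => kc /mem_rem /(allP Ps).
- rewrite /pair_weight [ltnRHS](perm_big _ pe) big_cat big_cons /= ltn_add2r.
  rewrite big_map /= big_const_nat subn0 iter_addn_0 kE expnMn ltn_pmul2l; last first.
    by rewrite expn_gt0 (P_gt0 (P_dvd Pk)).
  by rewrite -[X in (X < _)%N]expn1 ltn_exp2l // prime_gt1.
- rewrite [RHS](perm_big _ pe) big_cat big_cons /= big_map big_mkord.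
  by rewrite kE cE (kummer_poly_split _ _ l0 QE').
- rewrite [RHS](perm_big _ pe) big_cat big_cons /= big_map big_mkord.
  by rewrite kE cE (Phi_split _ Pk QE').
Qed.

(** The root given by exists_primitive_root is also a root of the right-hand
product, hence of the polynomial of some (k2, c2) with k dividing k2; maximality
of k forces k2 = k. *)
Lemma match_irreducible s t k c : all adm s -> all adm t ->
  \prod_(kc <- s) kummer_poly kc = \prod_(kc <- t) kummer_poly kc ->
  (k, c) \in s -> ~~ reducible (k, c) -> (forall kc, kc \in t -> (kc.1 <= k)%N) ->
  exists2 c2, (k, c2) \in t & (Q %| c - c2)%Z.
Proof.
move=> Ps Pt e ks irr kmax; have k0 := P_gt0 (allP Ps _ ks).
have [l lp lk lQ|x rx xP] := @exists_primitive_root k c k0.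
  apply: contra irr => lc; apply/hasP; exists l; rewrite ?lQ //.
  by rewrite mem_primes lp k0.
have : root (\prod_(kc <- t) kummer_poly kc) x.
  by rewrite -e (perm_big _ (perm_to_rem ks)) big_cons rootM rx.
have prod_root (u : seq (nat * int)) : root (\prod_(kc <- u) kummer_poly kc) x ->
    exists2 kc, kc \in u & root (kummer_poly kc) x.
  elim: u => [|kc u IH]; first by rewrite big_nil (negPf (root1 _)).
  rewrite big_cons rootM => /orP[r|/IH[kc' ku r]]; first by exists kc; rewrite ?mem_head.
  by exists kc'; rewrite // inE ku orbT.
move=> /prod_root[[k2 c2] kt /xP[kk2 cc2]].
have k2k : k2 = k.
  apply/eqP; rewrite eqn_leq (kmax _ kt) dvdn_leq //.
  exact: (P_gt0 (allP Pt _ kt)).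
by exists c2; [rewrite -k2k | apply: cc2].
Qed.

Lemma pair_weight_rem s kc : kc \in s -> adm kc ->
  (pair_weight (rem kc s) < pair_weight s)%N.
Proof.
move=> ks Pk; rewrite /pair_weight [ltnRHS](perm_big _ (perm_to_rem ks)) big_cons.
by rewrite -[ltnLHS]add0n ltn_add2r expn_gt0 (P_gt0 Pk).
Qed.

(** Induction on the total weight: split a reducible pair if there is one;
otherwise a pair with the largest first component occurs, modulo Q, on the other
side too, and both occurrences are removed. *)
Theorem kummer_poly_relation s t : all adm s -> all adm t ->
  \prod_(kc <- s) kummer_poly kc = \prod_(kc <- t) kummer_poly kc ->
  \prod_(kc <- s) Phi kc = \prod_(kc <- t) Phi kc.
Proof.
have [n] := ubnP (pair_weight s + pair_weight t)%N.
elim: n s t => // n IH s t; rewrite ltnS => wn Ps Pt e.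
have [hs|irr_s] := boolP (has reducible s).
  have [s' [Ps' ws' es' <-]] := split_reducible Ps hs.
  apply: IH => //; last by rewrite es'.
  by apply: leq_trans wn; rewrite ltn_add2r.
have [ht|irr_t] := boolP (has reducible t).
  have [t' [Pt' wt' et' <-]] := split_reducible Pt ht.
  apply: IH => //; last by rewrite et'.
  by apply: leq_trans wn; rewrite ltn_add2l.
have cancel u v k c : all adm u -> all adm v ->
    (pair_weight u + pair_weight v <= n)%N ->
    \prod_(kc <- u) kummer_poly kc = \prod_(kc <- v) kummer_poly kc ->
    (k, c) \in u -> ~~ has reducible u ->
    (forall kc, kc \in v -> (kc.1 <= k)%N) ->
    \prod_(kc <- u) Phi kc = \prod_(kc <- v) Phi kc.
  move=> Pu Pv wuv euv ku irr kmax.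
  have Pk := allP Pu _ ku.
  have irrk : ~~ reducible (k, c) by apply: (hasPn irr).
  have [c2 kv cc2] := match_irreducible Pu Pv euv ku irrk kmax.
  rewrite (perm_big _ (perm_to_rem ku)) [RHS](perm_big _ (perm_to_rem kv)) !big_cons.
  rewrite (Phi_congr k cc2); congr (_ * _); apply: IH.
  - apply: leq_trans wuv; rewrite -addSn leq_add ?pair_weight_rem //.
    by rewrite ltnW // pair_weight_rem.
  - by apply/allP => kc /mem_rem /(allP Pu).
  - by apply/allP => kc /mem_rem /(allP Pv).
  move: euv; rewrite (perm_big _ (perm_to_rem ku)) [RHS](perm_big _ (perm_to_rem kv)).
  rewrite !big_cons (kummer_poly_congr k cc2); apply: mulfI.
  by rewrite monic_neq0 // kummer_poly_monic // (P_gt0 Pk).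
have [nil_st|[kc0 kc0_st]] : s ++ t = [::] \/ exists kc0, kc0 \in s ++ t.
  by case: (s ++ t) => [|kc0 u]; [left|right; exists kc0; rewrite mem_head].
  by case: s nil_st {wn Ps e irr_s cancel} => //= ->.
have [[k c] kc_st kmax] : exists2 kc, kc \in s ++ t &
    forall kc', kc' \in s ++ t -> (kc'.1 <= kc.1)%N.
  elim: (s ++ t) kc0 kc0_st {cancel} => // kc u IHu _ _.
  case: u IHu => [_|kc1 u /(_ kc1 (mem_head _ _))[m mu mmax]].
    by exists kc => [|kc']; rewrite inE // => /eqP ->.
  have [le_m|lt_m] := leqP kc.1 m.1.
    by exists m => [|kc']; rewrite inE ?mu ?orbT // => /orP[/eqP -> //|/mmax].
  exists kc => [|kc']; rewrite inE ?eqxx // => /orP[/eqP -> //|/mmax le'].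
  exact: leq_trans le' (ltnW lt_m).
move: kc_st; rewrite mem_cat => /orP[ks|kt].
  by apply: cancel ks irr_s _ => // kc kct; apply: kmax; rewrite mem_cat kct orbT.
apply/esym; apply: cancel kt irr_t _ => // [|kc kcs]; first by rewrite addnC.
by apply: kmax; rewrite mem_cat kcs.
Qed.
End CyclotomicRelations.

(** * Comparison of the two hypergeometric sums *)

Lemma mup_eqp (K : fieldType) (x : K) (p q : {poly K}) :
  p != 0 -> q != 0 -> p %= q -> mup x p = mup x q.
Proof.
move=> p0 q0 pq; apply/eqP; rewrite eqn_leq mup_geq // mup_geq //.
by rewrite -(eqp_dvdr _ pq) -mup_geq // leqnn (eqp_dvdr _ pq) -mup_geq // leqnn.
Qed.

(** The derivative k X^(k - 1) vanishes at 0 only. *)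
Lemma mup_Xn_sub (K : fieldType) (k : nat) (x z : K) : k%:R != 0 :> K -> x != 0 ->
  mup x ('X^k - z%:P) = (x ^+ k == z) :> nat.
Proof.
move=> k0 x0; have k_gt0 : (0 < k)%N by rewrite lt0n; apply: contraNneq k0 => ->.
have p0 : 'X^k - z%:P != 0 :> {poly K} by rewrite monic_neq0 ?monicXnsubC.
case: eqP => xz; last by rewrite mupNroot // /root !hornerE subr_eq0; apply/eqP.
apply/eqP; rewrite eqn_leq mup_leq // mup_geq // expr1 dvdp_XsubCl.
rewrite [root _ _]/root !hornerE xz subrr eqxx andbT.
apply/negP => /dvdpP[r pE].
have := congr1 (fun p => (p^`()).[x]) pE.
rewrite derivB derivXn derivC subr0 derivM expr2 derivM !hornerE subrr /=.
rewrite !(mulr0, mul0r, addr0) => /eqP.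
rewrite hornerMn hornerXn.
by rewrite -mulr_natr mulf_eq0 (negPf k0) orbF expf_eq0 (negPf x0) andbF.
Qed.

(** With w a generator of the multiplicative group, chi w ^ i = 1 implies
chi ^ i = 1, so that i is 0 or at least the order of chi. *)
Lemma character_order_faithful (R : realType) (F : finFieldType) (chi : F -> R[i]) :
  multiplicative_character chi -> character_order chi (qx F) ->
  forall x, x != 0 -> chi x = 1 -> x = 1.
Proof.
move=> [chi1 chiM] [_ _ min_ord] x x0 chix.
have [w pw] := exists_primitive_element F.
have w0 : w != 0.
  apply/eqP => e; have := prim_expr_order pw.
  by rewrite e expr0n gtn_eqF ?predq_gt0 // => /esym/eqP; rewrite oner_eq0.
have [[[|i] i_lt] /= xE] := prim_rootP pw (expf_predq x0); first by rewrite xE expr0.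
have : (qx F <= i.+1)%N.
  apply: min_ord => // y y0; have [j ->] := prim_rootP pw (expf_predq y0).
  rewrite -(chiX chi1 chiM) ?expf_neq0 // -exprM mulnC exprM -xE.
  by rewrite (chiX chi1 chiM) // chix expr1n.
by rewrite leqNgt i_lt.
Qed.

Lemma scale_qxE (F : finFieldType) (a : rat) : (qx F)%:R * a \is a Num.int ->
  a = (scale_qx F a)%:~R / (qx F)%:R.
Proof.
move=> int_a; rewrite /scale_qx floorK // mulrC mulKf //.
by rewrite pnatr_eq0 -lt0n predq_gt0.
Qed.

Section Comparison.
Variables (R : realType) (F : finFieldType) (d n : nat).
Variables (gamma delta : 'I_d.+2 -> int) (N : nat) (alpha beta : 'I_n -> rat).
Hypothesis hgamma : gamma_triple gamma delta N.
Hypothesis hrep : represents R gamma delta N alpha beta.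
Hypothesis hgamma_def : F_q_gamma_defined F gamma N.
Hypothesis hparams_def : F_q_params_defined F alpha beta.

Local Notation Q := (qx F).
Let A i := scale_qx F (alpha i).
Let B i := scale_qx F (beta i).
Let c j := scale_qx F ((delta j)%:~R / N%:R).
Local Notation kummer := (kummer_poly R Q).

Lemma coprime_gamma j : coprime #|F| `|gamma j|.
Proof.
have [cop _] := hgamma_def; move: cop; rewrite (bigD1 j) //= abszM coprimeMr.
by case/andP.
Qed.

Lemma gamma_neq0 j : gamma j != 0.
Proof. by have [[]] := hgamma. Qed.

Lemma shiftE j : (delta j)%:~R / N%:R = (c j)%:~R / Q%:R :> rat.
Proof.
apply: scale_qxE; have [_ /dvdnP[e ->]] := hgamma_def; have [_ N0] := hgamma.
rewrite natrM mulrC -mulrA [e%:R * _]mulrC mulKf ?pnatr_eq0 -?lt0n //.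
by rewrite rpredM ?intr_int // ?natr_int.
Qed.

Lemma zeta_expz (k : int) : zeta R N ^ k = e2pii R (k%:~R / N%:R).
Proof. by rewrite /zeta -e2piiMz mulrC. Qed.

Lemma param_polyE (a : 'I_n -> rat) : (forall i, Q%:R * a i \is a Num.int) ->
  param_poly R a = \prod_(kc <- [seq (1%N, scale_qx F (a i)) | i <- index_enum 'I_n]) kummer kc.
Proof.
move=> int_a; rewrite big_map; apply: eq_bigr => i _.
by rewrite /kummer_poly /= expr1 -scale_qxE.
Qed.

Lemma gamma_numE : gamma_num R gamma delta N =
  \prod_(kc <- [seq (`|gamma j|%N, c j) | j <- index_enum 'I_d.+2 & gamma j < 0]) kummer kc.
Proof.
rewrite big_map big_filter; apply: eq_bigr => j _.
by rewrite /kummer_poly /= -shiftE zeta_expz.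
Qed.

Lemma gamma_denE : gamma_den R gamma delta N =
  \prod_(kc <- [seq (`|gamma j|%N, - c j) | j <- index_enum 'I_d.+2 & 0 < gamma j]) kummer kc.
Proof.
rewrite big_map big_filter; apply: eq_bigr => j _.
by rewrite /kummer_poly /= intrN mulNr -shiftE -mulNr -intrN zeta_expz.
Qed.

Let adm (kc : nat * int) := (0 < kc.1)%N && coprime #|F| kc.1.

Lemma adm_params (a : 'I_n -> int) : all adm [seq (1%N, a i) | i <- index_enum 'I_n].
Proof. by apply/allP => _ /mapP[i _ ->]; rewrite /adm /= coprimen1. Qed.

Lemma adm_gamma (P : pred 'I_d.+2) (c' : 'I_d.+2 -> int) :
  all adm [seq (`|gamma j|%N, c' j) | j <- index_enum 'I_d.+2 & P j].
Proof.
by apply/allP => _ /mapP[j _ ->]; rewrite /adm /= lt0n absz_eq0 gamma_neq0 coprime_gamma.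
Qed.

Lemma prod_kummer_monic s : all adm s -> \prod_(kc <- s) kummer kc \is monic.
Proof.
move=> /allP adm_s; rewrite big_seq; apply: monic_prod => kc /adm_s /andP[k0 _].
exact: kummer_poly_monic.
Qed.

(** The equality of fractions in represents, with denominators cleared. *)
Lemma cross_relation : param_poly R alpha * gamma_den R gamma delta N =
  gamma_num R gamma delta N * param_poly R beta.
Proof.
have [_ /eqP] := hrep; have [intA intB] := hparams_def.
have tofrac_neq0 (s : seq (nat * int)) : all adm s ->
    tofrac (\prod_(kc <- s) kummer kc) != 0.
  by move=> adm_s; rewrite tofrac_eq0 monic_neq0 ?prod_kummer_monic.
rewrite !param_polyE // gamma_numE gamma_denE eqr_div ?tofrac_neq0 ?adm_params ?adm_gamma //.
by rewrite -!tofracM tofrac_eq => /eqP.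
Qed.

Lemma mup_kummer (m : int) kc : adm kc ->
  mup (e2pii R (m%:~R / Q%:R)) (kummer kc) = (Q %| kc.1%:Z * m - kc.2)%Z.
Proof.
case: kc => k a /andP[/= k0 _]; rewrite /kummer_poly /= mup_Xn_sub ?e2pii_neq0 //; last first.
  by rewrite pnatr_eq0 -lt0n.
rewrite -e2piiMn -(e2pii_frac_eq R) ?predq_gt0 //; congr (nat_of_bool (e2pii R _ == _)).
by rewrite intrM -[LHS]mulr_natl mulrA.
Qed.

Lemma mup_prod_kummer (m : int) s : all adm s ->
  mup (e2pii R (m%:~R / Q%:R)) (\prod_(kc <- s) kummer kc) =
  (\sum_(kc <- s) (Q %| (kc.1%:Z * m - kc.2)%R)%Z)%N.
Proof.
elim: s => [|kc s IH] /=; first by rewrite !big_nil mupNroot ?root1.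
move=> /andP[adm_kc adm_s]; rewrite !big_cons mupM ?mup_kummer ?IH //.
  by case/andP: adm_kc => k0 _; rewrite monic_neq0 ?kummer_poly_monic.
by rewrite monic_neq0 ?prod_kummer_monic.
Qed.

(** Since num * P_beta = den * P_alpha with P_alpha and P_beta coprime, den
is gcd(num, den) * P_beta up to a constant.  Compare multiplicities at
exp(2 pi i m / Q); the roots of each factor of den are simple. *)
Lemma s_delta_eq (m : int) :
  (s_delta R F gamma delta N m + \sum_i (Q %| (m - B i)%R)%Z =
   \sum_(j | (0 < gamma j)%R) (Q %| (gamma j * m + c j)%R)%Z)%N.
Proof.
have [cop _] := hrep; have [intA intB] := hparams_def.
set x := e2pii R (m%:~R / Q%:R).
have den0 : gamma_den R gamma delta N != 0.
  by rewrite gamma_denE monic_neq0 ?prod_kummer_monic ?adm_gamma.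
have beta0 : param_poly R beta != 0.
  by rewrite param_polyE // monic_neq0 ?prod_kummer_monic ?adm_params.
have gcd0 : gamma_gcd R gamma delta N != 0 by rewrite gcdp_eq0 negb_and den0 orbT.
have den_eqp : gamma_gcd R gamma delta N * param_poly R beta %= gamma_den R gamma delta N.
  rewrite /gamma_gcd (eqp_ltrans (mulp_gcdl _ _ _)) -cross_relation.
  rewrite [param_poly R alpha * _]mulrC.
  rewrite -(eqp_ltrans (mulp_gcdr _ _ _)) -[X in _ %= X]mulr1 eqp_mul2l //.
  by rewrite -size_poly_eq1 -coprimep_def.
have := mup_eqp x (mulf_neq0 gcd0 beta0) den0 den_eqp.
rewrite mupM // param_polyE // mup_prod_kummer ?adm_params // gamma_denE.
rewrite mup_prod_kummer ?adm_gamma // !big_map big_filter /=.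
under [in X in (_ + X)%N]eq_bigr do rewrite mul1r.
move=> ->; apply: eq_bigr => j jpos; rewrite opprK.
by rewrite gtz0_abs.
Qed.
End Comparison.

Theorem theorem1p2 (R : realType) (F : finFieldType) (psi chi : F -> R[i])
    (hpsi : nontrivial_additive_character psi)
    (hchi : multiplicative_character chi)
    (hchi_order : character_order chi (qx F))
    (d n : nat) (gamma delta : 'I_d.+2 -> int) (N : nat)
    (alpha beta : 'I_n -> rat)
    (hgamma : gamma_triple gamma delta N)
    (hparams : hypergeometric_parameters alpha beta)
    (hrep : represents R gamma delta N alpha beta)
    (hgamma_def : F_q_gamma_defined F gamma N)
    (hparams_def : F_q_params_defined F alpha beta)
    (t : F) (ht : t != 0) :
  F_q_gamma psi chi gamma delta N t = F_q_params psi chi alpha beta t.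
Proof.
have [[psi0 psiD] psi_nt] := hpsi; have [chi1 chiM] := hchi.
have chi_inj := character_order_faithful hchi hchi_order.
have [intA intB] := hparams_def; have [[gam0 sum0 _] _] := hgamma.
have copr := coprime_gamma hgamma_def.
congr (_ * _); apply: eq_bigr => m _.
set A := fun i => scale_qx F (alpha i); set B := fun i => scale_qx F (beta i).
set c := fun j => scale_qx F ((delta j)%:~R / N%:R).
have LE := gamma_product psi0 psiD psi_nt chi1 chiM chi_inj c m%:Z ht gam0 sum0 copr.
have RE := params_product psi0 psiD psi_nt chi1 chiM chi_inj A B m%:Z ht.
rewrite exprnP mulrAC; apply: etrans (congr1 (fun z => z * _) LE) _.
apply/esym; rewrite exprnP; apply: etrans RE _.
set q : R[i] := #|F|%:R; have q0 : q != 0 by exact: natr_card_neq0.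
pose Phi := gauss_ratio psi chi m%:Z.
(* The polynomial identity num * P_beta = den * P_alpha, carried over to Phi. *)
have rel : \prod_i Phi (1%N, A i) * \prod_(j | 0 < gamma j) Phi (`|gamma j|%N, - c j) =
    \prod_(j | gamma j < 0) Phi (`|gamma j|%N, c j) * \prod_i Phi (1%N, B i).
  pose s := [seq (1%N, A i) | i <- index_enum 'I_n] ++
    [seq (`|gamma j|%N, - c j) | j <- index_enum 'I_d.+2 & 0 < gamma j].
  pose s' := [seq (`|gamma j|%N, c j) | j <- index_enum 'I_d.+2 & gamma j < 0] ++
    [seq (1%N, B i) | i <- index_enum 'I_n].
  pose adm k := (0 < k)%N && coprime #|F| k.
  have := @kummer_poly_relation R (qx F) (predq_gt0 F) R[i] adm Phi _ _ _ _ s s'.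
  rewrite !big_cat !big_map !big_filter /=; apply.
  - by move=> k /andP[].
  - move=> k l; rewrite /adm coprimeMr muln_gt0.
    by move=> /andP[/andP[-> _] /andP[-> _]].
  - by move=> k a b; apply: gauss_ratio_congr.
  - by move=> k l e a /andP[_ cop]; apply: gauss_ratio_split.
  - rewrite all_cat; apply/andP; split; last exact: adm_gamma hgamma hgamma_def _ _.
    exact: adm_params.
  - rewrite all_cat; apply/andP; split; first exact: adm_gamma hgamma hgamma_def _ _.
    exact: adm_params.
  have := cross_relation hgamma hrep hgamma_def hparams_def.
  rewrite (param_polyE _ intA) (param_polyE _ intB) (gamma_numE _ hgamma hgamma_def) (gamma_denE _ hgamma hgamma_def).
  by rewrite !big_map !big_filter.
have rel0 kc : coprime #|F| kc.1 -> Phi kc != 0.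
  by move=> /natr_coprime_neq0; apply: gauss_ratio_neq0.
have B0 : \prod_i Phi (1%N, B i) != 0.
  by apply/prodf_neq0 => i _; apply: rel0; rewrite coprimen1.
have den0 : \prod_(j | 0 < gamma j) Phi (`|gamma j|%N, - c j) != 0.
  by apply/prodf_neq0 => j _; apply: rel0; apply: copr.
rewrite -/Phi [RHS]mulrAC; congr (_ * _).
rewrite -[RHS]mulrA -expfzDr //; congr (_ * q ^ _).
  by apply/eqP; rewrite eqr_div // rel.
(* What remains is the equality of the exponents of q. *)
have PoszS (I : finType) (P : pred I) (f : I -> nat) :
    \sum_(i | P i) (f i)%:Z = (\sum_(i | P i) f i)%N%:Z.
  by rewrite (big_morph Posz PoszD (erefl _)).
have mult k := congr1 Posz (s_delta_eq hgamma hrep hgamma_def hparams_def k).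
have := mult 0; have := mult (- m%:Z); rewrite !PoszD -!PoszS => multm mult0.
rewrite !sumrB.
have -> : \sum_i (#|F|.-1 %| m%:Z + B i)%Z%:Z = \sum_i (qx F %| - m%:Z - B i)%Z%:Z.
  by apply: eq_bigr => i _; rewrite -opprD rpredN.
have -> : \sum_i (#|F|.-1 %| B i)%Z%:Z = \sum_i (qx F %| 0 - B i)%Z%:Z.
  by apply: eq_bigr => i _; rewrite sub0r rpredN.
have -> : \sum_(j | 0 < gamma j) (#|F|.-1 %| c j)%Z%:Z =
    \sum_(j | 0 < gamma j) (qx F %| gamma j * 0 + c j)%Z%:Z.
  by apply: eq_bigr => j _; rewrite mulr0 add0r.
have -> : \sum_(j | 0 < gamma j) (#|F|.-1 %| - gamma j * m%:Z + c j)%Z%:Z =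
    \sum_(j | 0 < gamma j) (qx F %| gamma j * - m%:Z + c j)%Z%:Z.
  by apply: eq_bigr => j _; rewrite mulNr mulrN.
have cancel (s0 sm y0 ym : int) : y0 - ym = s0 + y0 - (sm + ym) + (sm - s0) by ring.
by rewrite -multm -mult0; apply: cancel.
Qed.
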